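(* Let $A=t^a k[[t]]$, $a\in\mathbb{Z}$, be a fractional ideal of the local field $k((t))$. Assume that $H=\bigoplus_{\nu=1}^s \mathbb{Z}/p\mathbb{Z}$ is an elementary abelian group acting on $k((t))$ as the Galois group of $k((t))/k((t))^H$, with ramification filtration \[ H=H_0=\cdots=H_n> H_{n+1}=\{\mathrm{Id}\}. \] Then \[ \dim_k H^1(H,A)=\sum_{i=1}^s \left( \left\lfloor \frac{(n+1)(p-1)+a_i}{p} \right\rfloor-\left\lceil \frac{a_i}{p} \right\rceil \right), \] where the integers $a_i$ are defined recursively by $a_1=a$ and $a_i=\left\lceil \frac{a_{i-1}}{p} \right\rceil$ for $i\ge 2$. In particular, if $A=k[[t]]$, then \[ \dim_k H^1(H,k[[t]])=s \left\lfloor \frac{(n+1)(p-1)}{p} \right\rfloor . \]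
   Context: $k$ is an algebraically closed field of characteristic $p\ge 5$. The group $H$ is a finite group of continuous $k$-automorphisms of $k((t))$, and acts on the fractional ideal $A$ by restriction of this (Galois) action. $H_i$ denotes the $i$-th ramification group in lower numbering, $H_i=\{\sigma\in H: v_t(\sigma(t)-t)\ge i+1\}$. $H^1(H,A)$ is ordinary group cohomology. *)

(* Defs.v *)
From HB Require Import structures.
From mathcomp Require Import all_boot all_order all_algebra all_fingroup.
From mathcomp Require Import generic_quotient zify boolp.

Set Implicit Arguments.
Unset Strict Implicit.
Unset Printing Implicit Defensive.

Import Order.TTheory GRing.Theory Num.Theory.
Local Open Scope ring_scope.

(** * Formal power series k[[t]] *)

Record fps (k : Type) := Fps { coefs : nat -> k }.

HB.instance Definition _ (k : Type) := gen_eqMixin (fps k).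
HB.instance Definition _ (k : Type) := gen_choiceMixin (fps k).

Section PowerSeries.
Variable k : fieldType.
Implicit Types f g h : fps k.

Lemma fpsP f g : coefs f =1 coefs g -> f = g.
Proof. by case: f g => [f] [g] /= /funext ->. Qed.

Definition fps_const (c : k) := Fps (fun n => if n is 0%N then c else 0).
Definition fps_t : fps k := Fps (fun n => (n == 1%N)%:R).

Definition fps_opp f := Fps (fun n => - coefs f n).
Definition fps_add f g := Fps (fun n => coefs f n + coefs g n).
Definition fps_mul f g :=
  Fps (fun n => \sum_(j < n.+1) coefs f j * coefs g (n - j)).

Fact fps_addA : associative fps_add.
Proof. by move=> f g h; apply: fpsP => n; rewrite /= addrA. Qed.
Fact fps_addC : commutative fps_add.
Proof. by move=> f g; apply: fpsP => n; rewrite /= addrC. Qed.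
Fact fps_add0 : left_id (fps_const 0) fps_add.
Proof. by move=> f; apply: fpsP => -[|n]; rewrite /= add0r. Qed.
Fact fps_addN : left_inverse (fps_const 0) fps_opp fps_add.
Proof. by move=> f; apply: fpsP => -[|n]; rewrite /= addNr. Qed.

HB.instance Definition _ :=
  GRing.isZmodule.Build (fps k) fps_addA fps_addC fps_add0 fps_addN.

Fact fps_mulC : commutative fps_mul.
Proof.
move=> f g; apply: fpsP => n /=.
rewrite (reindex_inj rev_ord_inj) /=.
by apply: eq_bigr => j _; rewrite mulrC subSS subKn // -ltnS.
Qed.

Fact fps_mulA : associative fps_mul.
Proof.
move=> f g h; rewrite (fps_mulC g h); apply: fpsP => i.
rewrite [in RHS]fps_mulC /=.
pose c3 j l := coefs f j * (coefs g (i - j - l) * coefs h l).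
transitivity (\sum_(j < i.+1) \sum_(l < i.+1 | (l <= i - j)%N) c3 j l).
  apply: eq_bigr => /= j _; rewrite big_distrr /=.
  rewrite (big_ord_narrow_leq (leq_subr _ _)).
  by apply: eq_bigr => l _; rewrite /c3 /= (mulrC (coefs h _)).
rewrite (exchange_big_dep predT) //=; apply: eq_bigr => l _.
transitivity (\sum_(j < i.+1 | (j <= i - l)%N) c3 j l).
  apply: eq_bigl => j; rewrite -ltnS -(ltnS j) -!subSn ?leq_ord //.
  by rewrite -subn_gt0 -(subn_gt0 j) -!subnDA addnC.
rewrite (big_ord_narrow_leq (leq_subr _ _)) mulrC big_distrl /=.
by apply: eq_bigr => j _; rewrite /c3 -!subnDA addnC mulrA.
Qed.

Fact fps_mul1 : left_id (fps_const 1) fps_mul.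
Proof.
move=> f; apply: fpsP => n /=; rewrite big_ord_recl /= subn0 mul1r.
by rewrite big1 ?addr0 // => j _; rewrite mul0r.
Qed.

Fact fps_mulDl : left_distributive fps_mul +%R.
Proof.
move=> f g h; apply: fpsP => n /=; rewrite -big_split /=.
by apply: eq_bigr => j _; rewrite mulrDl.
Qed.

Fact fps_one_neq0 : fps_const 1 != 0.
Proof. by apply/eqP => /(congr1 (fun f => coefs f 0%N)) /eqP; rewrite /= oner_eq0. Qed.

HB.instance Definition _ := GRing.Zmodule_isComNzRing.Build (fps k)
  fps_mulA fps_mulC fps_mul1 fps_mulDl fps_one_neq0.

Lemma coefsM f g n : coefs (f * g) n = \sum_(j < n.+1) coefs f j * coefs g (n - j).
Proof. by []. Qed.

(* The first n + 1 coefficients of f^-1, when f has an invertible constant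
   coefficient. *)
Fixpoint fps_inv_seq f n : seq k :=
  if n is m.+1 then
    let s := fps_inv_seq f m in
    rcons s (- ((coefs f 0)^-1 * \sum_(j < n) coefs f j.+1 * s`_(m - j)))
  else [:: (coefs f 0)^-1].

Definition fps_unit : {pred fps k} := fun f => coefs f 0 != 0.
Definition fps_inv f :=
  if f \in fps_unit then Fps (fun n => (fps_inv_seq f n)`_n) else f.

Lemma size_fps_inv_seq f n : size (fps_inv_seq f n) = n.+1.
Proof. by elim: n => //= n IHn; rewrite size_rcons IHn. Qed.

Lemma nth_fps_inv_seq f m n : (m <= n)%N ->
  (fps_inv_seq f n)`_m = (fps_inv_seq f m)`_m.
Proof.
elim: n => [|n IHn]; first by rewrite leqn0 => /eqP->.
rewrite leq_eqVlt => /predU1P[-> //|lt_mn].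
by rewrite [in LHS]/= nth_rcons size_fps_inv_seq lt_mn IHn.
Qed.

Fact fps_mulV : {in fps_unit, left_inverse 1 fps_inv *%R}.
Proof.
move=> f f_unit; rewrite /fps_inv f_unit mulrC; apply: fpsP => -[|n].
  by rewrite coefsM big_ord_recl big_ord0 addr0 /= mulfV.
rewrite coefsM big_ord_recl /= nth_rcons size_fps_inv_seq ltnn eqxx.
rewrite mulrN mulrA mulfV // mul1r; apply/eqP.
rewrite addrC subr_eq0; apply/eqP/eq_bigr => j _.
by rewrite subSS (nth_fps_inv_seq _ (leq_subr _ _)).
Qed.

Fact fps_unitP f g : g * f = 1 -> f \in fps_unit.
Proof.
move/(congr1 (fun h => coefs h 0%N)); rewrite coefsM big_ord_recl big_ord0 /=.
rewrite addr0 subnn => gf1; apply/eqP => f0.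
by move/eqP: gf1; rewrite f0 mulr0 eq_sym oner_eq0.
Qed.

Fact fps_inv_out : {in [predC fps_unit], fps_inv =1 id}.
Proof. by move=> f; rewrite inE /fps_inv => /negbTE ->. Qed.

HB.instance Definition _ := GRing.ComNzRing_hasMulInverse.Build (fps k)
  fps_mulV fps_unitP fps_inv_out.

Lemma coefs0 n : coefs (0 : fps k) n = 0. Proof. by case: n. Qed.

Lemma fps_nonzeroP f : f != 0 -> exists n, coefs f n != 0.
Proof.
move=> f_neq0; apply: contrapT => no_n; case/eqP: f_neq0.
apply: fpsP => n; rewrite coefs0; apply: contrapT => /eqP fn_nz.
by apply: no_n; exists n.
Qed.

Definition fps_order f : nat :=
  if pselect (exists n, coefs f n != 0) is left ex_n then ex_minn ex_n else 0.

Lemma fps_orderP f : f != 0 ->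
  coefs f (fps_order f) != 0 /\ forall n, (n < fps_order f)%N -> coefs f n = 0.
Proof.
move=> /fps_nonzeroP f_nz; rewrite /fps_order; case: pselect => // ex_n.
case: ex_minnP => m fm min_m; split=> // n lt_nm; apply/eqP.
by apply: contraTT lt_nm => /min_m; rewrite -leqNgt.
Qed.

Lemma coefsM_order f g : f != 0 -> g != 0 ->
  let m := (fps_order f + fps_order g)%N in
  coefs (f * g) m != 0 /\ forall n, (n < m)%N -> coefs (f * g) n = 0.
Proof.
move=> /fps_orderP[f_nz f_lt] /fps_orderP[g_nz g_lt] /=; split=> [|n lt_n].
  have lt_f : (fps_order f < (fps_order f + fps_order g).+1)%N.
    by rewrite ltnS leq_addr.
  rewrite (bigD1 (Ordinal lt_f)) //= addKn big1 ?addr0 ?mulf_neq0 //.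
  move=> j; rewrite -val_eqE /= neq_ltn => /orP[/f_lt ->|lt_fj].
    by rewrite mul0r.
  rewrite g_lt ?mulr0 // ltn_subLR; last by rewrite -ltnS.
  by rewrite ltn_add2r.
rewrite big1 // => j _; have [/f_lt ->|le_fj] := ltnP j (fps_order f).
  by rewrite mul0r.
rewrite g_lt ?mulr0 // ltn_subLR; last by rewrite -ltnS.
by apply: leq_trans lt_n _; rewrite leq_add2r.
Qed.

Fact fps_integral : GRing.integral_domain_axiom (fps k).
Proof.
move=> f g fg0; have [//|f_nz] := eqVneq f 0; have [//|g_nz] := eqVneq g 0.
have [] := coefsM_order f_nz g_nz.
by rewrite fg0 coefs0 eqxx.
Qed.

HB.instance Definition _ := GRing.ComUnitRing_isIntegral.Build (fps k)
  fps_integral.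

Lemma fps_orderM f g : f != 0 -> g != 0 ->
  fps_order (f * g) = (fps_order f + fps_order g)%N.
Proof.
move=> f_nz g_nz; have [m_nz m_lt] := coefsM_order f_nz g_nz.
have [n_nz n_lt] := fps_orderP (mulf_neq0 f_nz g_nz).
apply/eqP; rewrite eqn_leq; apply/andP; split; rewrite leqNgt.
  by apply: contra_notN (negP m_nz) => /n_lt ->.
by apply: contra_notN (negP n_nz) => /m_lt ->.
Qed.

Fact fps_const_is_zmod_morphism : zmod_morphism fps_const.
Proof. by move=> c d; apply: fpsP => -[|n] /=; rewrite ?subr0. Qed.
Fact fps_const_is_monoid_morphism : monoid_morphism fps_const.
Proof.
split=> // c d; apply: fpsP => n; rewrite coefsM big_ord_recl big1 ?addr0.
  by case: n => [|n] //=; rewrite mulr0.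
by move=> j _; rewrite mul0r.
Qed.
HB.instance Definition _ :=
  GRing.isZmodMorphism.Build k (fps k) fps_const fps_const_is_zmod_morphism.
HB.instance Definition _ :=
  GRing.isMonoidMorphism.Build k (fps k) fps_const fps_const_is_monoid_morphism.

Lemma fps_t_neq0 : fps_t != 0.
Proof.
by apply/eqP => /(congr1 (fun f => coefs f 1%N)) /eqP; rewrite /= oner_eq0.
Qed.

Lemma coefs_tM f n : coefs (fps_t * f) n = if n is m.+1 then coefs f m else 0.
Proof.
case: n => [|n]; first by rewrite coefsM big_ord_recl big_ord0 /= mul0r addr0.
rewrite coefsM big_ord_recl /= mul0r add0r big_ord_recl /= mul1r subSS subn0.
by rewrite big1 ?addr0 // => j _; rewrite mul0r.
Qed.

Lemma fps_order_t : fps_order fps_t = 1%N.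
Proof.
have [t_nz t_lt] := fps_orderP fps_t_neq0.
by case: fps_order t_nz => [|[|n]] //=; rewrite eqxx.
Qed.

Lemma fps_order_unit f : f \is a GRing.unit -> fps_order f = 0%N.
Proof.
move=> f_unit; have f_nz : f != 0.
  by apply: contraTneq f_unit => ->; rewrite unitr0.
have [_ f_lt] := fps_orderP f_nz; apply/eqP; rewrite -leqn0 leqNgt.
by apply: contraL f_unit => /f_lt f0; apply/negP => /eqP; apply.
Qed.

Lemma fps_order_factor f : f != 0 ->
  exists2 u, u \is a GRing.unit & f = fps_t ^+ fps_order f * u.
Proof.
move=> /fps_orderP; move: (fps_order f) => m [f_nz f_lt].
exists (Fps (fun n => coefs f (n + m))); first exact: f_nz.
elim: m f f_lt {f_nz} => [|m IHm] f f_lt.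
  by rewrite expr0 mul1r; apply: fpsP => n /=; rewrite addn0.
rewrite exprS -mulrA.
have fE : f = fps_t * Fps (fun n => coefs f n.+1).
  by apply: fpsP => -[|n]; rewrite coefs_tM //= f_lt.
rewrite [LHS]fE; congr (_ * _); rewrite [LHS]IHm /= => [|n lt_nm].
  by congr (_ * _); apply: fpsP => n /=; rewrite addnS.
exact: f_lt.
Qed.

End PowerSeries.

(** * The local field k((t)) *)

Definition laurent (k : fieldType) := {fraction fps k}.

HB.instance Definition _ (k : fieldType) := GRing.Field.on (laurent k).

Section Laurent.
Variable k : fieldType.
Implicit Types (x y : laurent k) (f g : fps k) (a m : int) (c : k).

Definition fps_to_laurent : fps k -> laurent k := @FracField.tofrac (fps k).
HB.instance Definition _ := GRing.RMorphism.on fps_to_laurent.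

Definition laurent_scale c x := fps_to_laurent (fps_const c) * x.
Fact laurent_scaleA b c x :
  laurent_scale b (laurent_scale c x) = laurent_scale (b * c) x.
Proof. by rewrite /laurent_scale mulrA !rmorphM. Qed.
Fact laurent_scale1 : left_id 1 laurent_scale.
Proof. by move=> x; rewrite /laurent_scale !rmorph1 mul1r. Qed.
Fact laurent_scaleDr : right_distributive laurent_scale +%R.
Proof. by move=> c x y; rewrite /laurent_scale mulrDr. Qed.
Fact laurent_scaleDl x : {morph laurent_scale^~ x : b c / b + c}.
Proof. by move=> b c; rewrite /laurent_scale !rmorphD mulrDl. Qed.
HB.instance Definition _ := GRing.Zmodule_isLmodule.Build k (laurent k)
  laurent_scaleA laurent_scale1 laurent_scaleDr laurent_scaleDl.

Fact laurent_scaleAl c x y : c *: (x * y) = (c *: x) * y.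
Proof. exact: mulrA. Qed.
HB.instance Definition _ := GRing.Lmodule_isLalgebra.Build k (laurent k)
  laurent_scaleAl.

Definition laurent_t : laurent k := fps_to_laurent (fps_t k).

(* The t-adic valuation of x = f / g is ord_t f - ord_t g. It is meaningful for
   x != 0 only; the convention v_t 0 = +oo is built into [vt_ge]. *)
Definition vt x : int :=
  (fps_order \n_(repr x))%:Z - (fps_order \d_(repr x))%:Z.

Definition vt_ge m x : bool := (x == 0) || (m <= vt x).

(* The fractional ideal t^a k[[t]]. *)
Definition frac_ideal a : {pred laurent k} :=
  fun x => `[< exists f, x = laurent_t ^ a * fps_to_laurent f >].

Lemma fps_to_laurent_eq0 f : (fps_to_laurent f == 0) = (f == 0).
Proof. exact: tofrac_eq0. Qed.

Lemma laurent_numden x :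
  x * fps_to_laurent \d_(repr x) = fps_to_laurent \n_(repr x).
Proof.
rewrite -{1}[x]reprK /fps_to_laurent; unlock FracField.tofrac.
rewrite -[LHS]FracField.pi_mul; apply/eqmodP => /=.
rewrite FracField.equivfE /FracField.mulf.
by rewrite !numden_Ratio ?mulf_neq0 ?oner_eq0 ?denom_ratioP // !mulr1 mulrC.
Qed.

Lemma vt_frac f g : f != 0 -> g != 0 ->
  vt (fps_to_laurent f / fps_to_laurent g) =
  (fps_order f)%:Z - (fps_order g)%:Z.
Proof.
move=> f_nz g_nz; set x := _ / _; rewrite /vt.
have d_nz : \d_(repr x) != 0 by exact: denom_ratioP.
have: fps_to_laurent (\n_(repr x) * g) = fps_to_laurent (\d_(repr x) * f).
  rewrite !rmorphM /= -laurent_numden /x mulrAC mulfVK ?fps_to_laurent_eq0 //.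
  exact: mulrC.
move/eqP; rewrite -subr_eq0 -rmorphB fps_to_laurent_eq0 subr_eq0 => /eqP fg.
have n_nz : \n_(repr x) != 0.
  apply: contra_neq (mulf_neq0 d_nz f_nz) => n0.
  by rewrite -fg n0 mul0r.
have /(congr1 Posz) := congr1 (@fps_order k) fg.
by rewrite !fps_orderM // !PoszD; lia.
Qed.

Lemma vt_geP m x : reflect (exists f, x = laurent_t ^ m * fps_to_laurent f) (vt_ge m x).
Proof.
have tL_nz : laurent_t != 0 by rewrite fps_to_laurent_eq0 fps_t_neq0.
have toLU u : u \is a GRing.unit ->
    fps_to_laurent u^-1 = (fps_to_laurent u)^-1 by exact: rmorphV.
apply: (iffP idP) => [|[f ->]].
  have [-> _|x_nz] := eqVneq x 0; first by exists 0; rewrite rmorph0 mulr0.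
  rewrite /vt_ge (negbTE x_nz) /= /vt => m_le.
  have d_nz : \d_(repr x) != 0 by exact: denom_ratioP.
  have n_nz : \n_(repr x) != 0.
    by rewrite -fps_to_laurent_eq0 -laurent_numden mulf_neq0 ?fps_to_laurent_eq0.
  have [u u_unit nE] := fps_order_factor n_nz.
  have [v v_unit dE] := fps_order_factor d_nz.
  move: (fps_order _) (fps_order _) m_le nE dE => j i m_le nE dE.
  exists (fps_t k ^+ absz (i%:Z - j%:Z - m)%R * (u * v^-1)).
  have dL_nz : fps_to_laurent \d_(repr x) != 0 by rewrite fps_to_laurent_eq0.
  apply: (mulIf dL_nz); rewrite laurent_numden nE dE !rmorphM !rmorphXn /= toLU //.
  have vL_nz : fps_to_laurent v != 0.
    rewrite fps_to_laurent_eq0; apply: contraTneq v_unit => ->.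
    by rewrite unitr0.
  have tE : laurent_t ^ m * laurent_t ^+ absz (i%:Z - j%:Z - m)%R * laurent_t ^+ j = laurent_t ^+ i.
    by rewrite !exprnP -!expfzDr //; congr (_ ^ _); lia.
  rewrite -[fps_to_laurent (fps_t k)]/laurent_t -tE.
  move: (fps_to_laurent u) (fps_to_laurent v) vL_nz => U V V_nz.
  rewrite -!mulrA; do 2![congr (_ * _)].
  by rewrite [V^-1 * _]mulrCA mulVf // mulr1 mulrC.
rewrite /vt_ge; have [-> | x_nz] //= := eqVneq; move: x_nz.
rewrite mulf_eq0 negb_or fps_to_laurent_eq0 => /andP[_ f_nz].
have ordX n : fps_order (fps_t k ^+ n) = n.
  elim: n => [|n IHn]; first by rewrite expr0 fps_order_unit ?unitr1.
  by rewrite exprS fps_orderM ?expf_neq0 ?fps_t_neq0 // IHn fps_order_t.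
have tX_nz n : fps_t k ^+ n != 0 by rewrite expf_neq0 ?fps_t_neq0.
case: m => n.
  rewrite -exprnP /laurent_t -rmorphXn -rmorphM -[X in vt X]divr1 -(rmorph1 fps_to_laurent).
  rewrite vt_frac ?mulf_neq0 ?oner_eq0 // fps_orderM // ordX.
  by rewrite (fps_order_unit (unitr1 _)); lia.
rewrite NegzE -exprnN /laurent_t -rmorphXn mulrC vt_frac // ordX.
by lia.
Qed.

Fact frac_ideal_submod a : subsemimod_closed (frac_ideal a).
Proof.
split=> [|c x /asboolP[f ->]].
  split=> [|x y /asboolP[f ->] /asboolP[g ->]]; apply/asboolP.
    by exists 0; rewrite rmorph0 mulr0.
  by exists (f + g); rewrite rmorphD mulrDr.
apply/asboolP; exists (fps_const c * f).
by rewrite rmorphM mulrCA.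
Qed.
HB.instance Definition _ a :=
  GRing.isSubmodClosed.Build k (laurent k) (frac_ideal a) (frac_ideal_submod a).

Definition vt_continuous (u : laurent k -> laurent k) :=
  forall x m, exists N, forall y, vt_ge N (y - x) -> vt_ge m (u y - u x).

End Laurent.

(** * Group cohomology in degree one *)

Section QuotientModule.
Variables (k : pzRingType) (V : lmodType k) (W : submodClosed V).
Implicit Types (c : k) (v w : V).
Local Open Scope quotient_scope.

(* [submodClosed] does not inherit from [zmodClosed], which [Quotient.quot]
   requires. *)
Definition submod_zmod : {pred V} := fun v => v \in W.
HB.instance Definition _ := GRing.isZmodClosed.Build V submod_zmod
  (GRing.submod_closedB (submodClosedP W)).

Definition quotmod := @Quotient.quot V submod_zmod.
HB.instance Definition _ := GRing.Zmodule.on quotmod.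
HB.instance Definition _ := EqQuotient.on quotmod.

Lemma quotmod_piD : {morph \pi_quotmod : v w / v + w}.
Proof. exact: (raddfD \pi_(@Quotient.quot V submod_zmod)). Qed.

Lemma quotmod_eqP v w :
  reflect (\pi_quotmod v = \pi_quotmod w) (v - w \in W).
Proof.
by rewrite -[_ \in W]/(_ \in submod_zmod) Quotient.idealrBE; apply: eqP.
Qed.

Definition quotmod_scale c (u : quotmod) : quotmod := \pi_quotmod (c *: repr u).

Lemma quotmod_piZ c v : \pi_quotmod (c *: v) = quotmod_scale c (\pi_quotmod v).
Proof.
apply/quotmod_eqP; rewrite -scalerBr rpredZ //.
by apply/quotmod_eqP; rewrite reprK.
Qed.

Fact quotmod_scaleA b c u :
  quotmod_scale b (quotmod_scale c u) = quotmod_scale (b * c) u.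
Proof. by rewrite -[u]reprK -!quotmod_piZ scalerA reprK. Qed.
Fact quotmod_scale1 : left_id 1 quotmod_scale.
Proof. by move=> u; rewrite -[u]reprK -quotmod_piZ scale1r. Qed.
Fact quotmod_scaleDr : right_distributive quotmod_scale +%R.
Proof.
move=> c u1 u2; rewrite -[u1]reprK -[u2]reprK.
by rewrite -quotmod_piD -!quotmod_piZ -quotmod_piD scalerDr.
Qed.
Fact quotmod_scaleDl u : {morph quotmod_scale^~ u : b c / b + c}.
Proof.
by move=> b c; rewrite -[u]reprK -!quotmod_piZ -quotmod_piD scalerDl.
Qed.
HB.instance Definition _ := GRing.Zmodule_isLmodule.Build k quotmod
  quotmod_scaleA quotmod_scale1 quotmod_scaleDr quotmod_scaleDl.

End QuotientModule.

(* H^1(G, A) = Z^1 / B^1 for A = t^a k[[t]] and G acting on k((t)) through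
   sigma. Since A need not be closed under an arbitrary sigma, 1-cochains are
   functions G -> k((t)) with values in A; continuous automorphisms do preserve
   A. *)
Section FirstCohomology.
Variables (k : fieldType) (gT : finGroupType).
Variable sigma : gT -> {lrmorphism laurent k -> laurent k}.
Variable a : int.

Definition cocycle : {pred {ffun gT -> laurent k}} := fun f =>
  `[< (forall g, f g \in frac_ideal a) /\
      (forall g h, f (g * h)%g = f g + sigma g (f h)) >].

Fact cocycle_submod : subsemimod_closed cocycle.
Proof.
split=> [|c f /asboolP[fA fZ]].
  split=> [|f1 f2 /asboolP[fA fZ] /asboolP[gA gZ]]; apply/asboolP; split.
  - by move=> g; rewrite ffunE rpred0.
  - by move=> g h; rewrite !ffunE raddf0 addr0.
  - by move=> g; rewrite ffunE rpredD.
  - by move=> g h; rewrite !ffunE fZ gZ raddfD addrACA.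
apply/asboolP; split=> [g|g h]; rewrite !ffunE ?rpredZ //.
by rewrite fZ scalerDr linearZ.
Qed.
HB.instance Definition _ :=
  GRing.isSubmodClosed.Build k {ffun gT -> laurent k} cocycle cocycle_submod.

Record Z1 := Cocycle {
  cocycle_fun :> {ffun gT -> laurent k};
  cocycle_funP : cocycle_fun \in cocycle }.
HB.instance Definition _ := [isSub for cocycle_fun].
HB.instance Definition _ := [Choice of Z1 by <:].
HB.instance Definition _ := [SubChoice_isSubLmodule of Z1 by <:].

Definition coboundary : {pred Z1} := fun f =>
  `[< exists2 m, m \in frac_ideal a & forall g, f g = sigma g m - m >].

Fact coboundary_submod : subsemimod_closed coboundary.
Proof.
split=> [|c f /asboolP[m mA fB]].
  split=> [|f1 f2 /asboolP[m mA fB] /asboolP[n nA gB]]; apply/asboolP.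
    by exists 0 => [|g]; rewrite ?rpred0 // ffunE raddf0 subr0.
  exists (m + n) => [|g]; rewrite ?rpredD // ffunE.
  by rewrite (fB g : cocycle_fun _ _ = _) (gB g : cocycle_fun _ _ = _) raddfD opprD addrACA.
apply/asboolP; exists (c *: m) => [|g]; rewrite ?rpredZ // ffunE.
by rewrite (fB g : cocycle_fun _ _ = _) scalerBr [sigma g (_ *: _)]linearZ.
Qed.
HB.instance Definition _ :=
  GRing.isSubmodClosed.Build k Z1 coboundary coboundary_submod.

Definition H1 : lmodType k := quotmod coboundary.

End FirstCohomology.

Definition has_dim (k : fieldType) (V : lmodType k) (d : nat) : Prop :=
  inhabited (Vector.axiom d V).

(** * Galois actions on k((t)) and ramification *)

Section Ramification.
Variables (k : fieldType) (gT : finGroupType).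
Variable sigma : gT -> {lrmorphism laurent k -> laurent k}.

(* A finite group of continuous k-automorphisms of k((t)), presented as a
   faithful action of an abstract finite group. By Artin's theorem, k((t)) is
   then Galois over its fixed field, with this group as Galois group. *)
Record galois_action : Prop := GaloisAction {
  galois_act1 : sigma 1%g =1 id;
  galois_actM : forall g h, sigma (g * h)%g =1 sigma g \o sigma h;
  galois_act_faithful : forall g, sigma g =1 id -> g = 1%g;
  galois_act_continuous : forall g, vt_continuous (sigma g) }.

Definition ram_group (i : nat) : {set gT} :=
  [set g | vt_ge i.+1%:Z (sigma g (@laurent_t k) - @laurent_t k)].

End Ramification.

(* a_1 = a and a_(i + 1) = ceil (a_i / p); the value at index 0 is unused. *)
Fixpoint ceil_seq (p : nat) (a : int) (i : nat) : int :=
  if i is (_.+1 as j).+1 then Num.ceil ((ceil_seq p a j)%:~R / p%:R : rat)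
  else a.

(* Main.v *)
(** Let K = k((t)) and A = t^a k[[t]]. Since H^1(H, K) = 0, every cocycle with
    values in A is h |-> h f - f for some f in K, so that H^1(H, A) is the space
    of all f with h f - f in A for every h in H, modulo A + K^H.

    Choose a chain 1 = G_0 < ... < G_s = H with steps of order p. By
    Artin-Schreier theory, each fixed field K^(G_i) has value group p^i Z, and
    for every h outside G_i, h - 1 raises valuations there by at least p^i n,
    with equality exactly for the valuations p^i e with p not dividing e: the
    quotient H / G_i again has the single jump n. If u_i is an element of
    K^(G_i) of valuation p^i, the powers u_i^e with p not dividing e and
    a - p^i n <= p^i e < a therefore satisfy the condition above. They are
    independent modulo A + K^H because their valuations are distinct, smaller
    than a, and not divisible by p^s; they span because any f in K^(G_i)
    satisfying the condition can be reduced, leading term by leading term, to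
    K^(G_{i+1}) + A. For each i, the number of these exponents e is the i-th
    term of the sum. *)
Require Import Defs.
From HB Require Import structures.
From mathcomp Require Import all_boot all_order all_algebra all_fingroup.
From mathcomp Require Import cyclic abelian mxabelem boolp zify ring.

Set Implicit Arguments.
Unset Strict Implicit.
Unset Printing Implicit Defensive.

Import Order.TTheory GRing.Theory Num.Theory.
Local Open Scope ring_scope.

(** * Discrete valuations *)

Definition val_ge (K : fieldType) (v : K -> int) (m : int) (x : K) : bool :=
  (x == 0) || (m <= v x).

(* [v 0] is a junk value. The last axiom says that the residue field is k. *)
Record valuation (k K : fieldType) (iota : k -> K) (v : K -> int) : Prop :=
  Valuation {
    val_geD : forall m x y,
      val_ge v m x -> val_ge v m y -> val_ge v m (x + y);
    valM : forall x y, x != 0 -> y != 0 -> v (x * y) = v x + v y;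
    val_const : forall c, c != 0 -> v (iota c) = 0;
    val_lead : forall x y, x != 0 -> y != 0 -> v x = v y ->
      exists2 c, c != 0 & val_ge v (v x + 1) (x - iota c * y) }.

Section Valuation.
Variables (k K : fieldType) (iota : {rmorphism k -> K}) (v : K -> int).
Hypothesis Kv : valuation iota v.
Local Notation vge := (val_ge v).
Implicit Types (x y z : K) (m n : int) (c : k).

Lemma val_ge_neq0 m x : x != 0 -> vge m x = (m <= v x).
Proof. by rewrite /val_ge => /negPf->. Qed.

Lemma val_ge0 m : vge m 0. Proof. by rewrite /val_ge eqxx. Qed.

Lemma val_ge_val x : vge (v x) x. Proof. by rewrite /val_ge lexx orbT. Qed.

Lemma val_ge_le m n x : m <= n -> vge n x -> vge m x.
Proof.
by move=> le_mn; rewrite /val_ge => /orP[->//|/(le_trans le_mn)->]; rewrite orbT.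
Qed.

Lemma val1 : v 1 = 0.
Proof. by rewrite -(rmorph1 iota) (val_const Kv) ?oner_neq0. Qed.

Lemma val_ge_const c : vge 0 (iota c).
Proof.
have [->|c0] := eqVneq c 0; first by rewrite rmorph0 val_ge0.
by rewrite val_ge_neq0 ?fmorph_eq0 // (val_const Kv).
Qed.

Lemma val_geM m n x y : vge m x -> vge n y -> vge (m + n) (x * y).
Proof.
have [->|x0] := eqVneq x 0; first by rewrite mul0r !val_ge0.
have [->|y0] := eqVneq y 0; first by rewrite mulr0 !val_ge0.
by rewrite !val_ge_neq0 ?mulf_neq0 // (valM Kv) //; apply: lerD.
Qed.

Lemma val_geZ m c x : vge m x -> vge m (iota c * x).
Proof. by move=> mx; rewrite -[m]add0r; apply: val_geM (val_ge_const _) mx. Qed.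

Lemma val_geN m x : vge m x -> vge m (- x).
Proof. by move/(val_geZ (-1)); rewrite rmorphN1 mulN1r. Qed.

Lemma val_geB m x y : vge m x -> vge m y -> vge m (x - y).
Proof. by move=> mx my; apply/(val_geD Kv)/val_geN. Qed.

Lemma val_ge_sum m (I : Type) (r : seq I) (P : pred I) (F : I -> K) :
  (forall i, P i -> vge m (F i)) -> vge m (\sum_(i <- r | P i) F i).
Proof.
by move=> mF; apply: (big_ind (vge m)); [apply: val_ge0|apply: (val_geD Kv)|].
Qed.

Lemma val_geX m x e : vge m x -> vge (m * e%:Z) (x ^+ e).
Proof.
move=> mx; elim: e => [|e IHe]; last by rewrite exprS intS mulrDr mulr1 val_geM.
by rewrite mulr0 expr0 -(rmorph1 iota) val_ge_const.
Qed.

Lemma val_ge_scaled c x m : c != 0 -> vge m (iota c * x) = vge m x.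
Proof.
move=> c0; apply/idP/idP => [/(val_geZ c^-1)|/val_geZ//].
by rewrite mulrA -rmorphM mulVf // rmorph1 mul1r.
Qed.

Lemma valV x : x != 0 -> v x^-1 = - v x.
Proof.
move=> x0; apply/eqP; rewrite -addr_eq0 -(valM Kv) ?invr_eq0 //.
by rewrite mulVf // val1.
Qed.

Lemma valX x e : x != 0 -> v (x ^+ e) = v x * e%:Z.
Proof.
move=> x0; elim: e => [|e IHe]; first by rewrite expr0 mulr0 val1.
by rewrite exprS (valM Kv) ?expf_neq0 // IHe intS mulrDr mulr1.
Qed.

Lemma valXz x m : x != 0 -> v (x ^ m) = v x * m.
Proof.
move=> x0; case: m => e; first by rewrite -exprnP valX.
by rewrite NegzE -exprnN valV ?expf_neq0 // valX // mulrN.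
Qed.

Lemma valZ c x : c != 0 -> v (iota c * x) = v x.
Proof.
move=> c0; have [->|x0] := eqVneq x 0; first by rewrite mulr0.
by rewrite (valM Kv) ?fmorph_eq0 // (val_const Kv) // add0r.
Qed.

Lemma val_addl x y m : x != 0 -> v x < m -> vge m y ->
  x + y != 0 /\ v (x + y) = v x.
Proof.
move=> x0 lt_m my; have yge : vge (v x + 1) y by apply: val_ge_le my; lia.
have xy0 : x + y != 0.
  apply: contraTneq yge => /(canRL (addKr _)); rewrite addr0 => ->.
  by apply/negP => /val_geN; rewrite opprK val_ge_neq0 //; lia.
split=> //; apply/eqP; rewrite eq_le -[_ <= v (_ + _)]val_ge_neq0 //.
rewrite (val_geD Kv) ?val_ge_val // ?andbT; last by apply: val_ge_le yge; lia.
rewrite leNgt -lezD1 -val_ge_neq0 //; apply/negP => /val_geB/(_ yge).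
by rewrite addrK val_ge_neq0 //; lia.
Qed.

Lemma val_split x y : x != 0 -> y != 0 -> v x = v y ->
  exists2 c, c != 0 & exists2 z, vge (v x + 1) z & x = iota c * y + z.
Proof.
move=> x0 y0 /(val_lead Kv x0 y0)[c c0 xy]; exists c => //.
by exists (x - iota c * y); rewrite // addrC subrK.
Qed.

Lemma val_residue x : x != 0 -> v x = 0 ->
  exists2 c, c != 0 & vge 1 (x - iota c).
Proof.
move=> x0 vx; have [|c c0] := val_lead Kv x0 (oner_neq0 K); first by rewrite val1.
by rewrite vx mulr1; exists c.
Qed.

End Valuation.

(** * Ramification jumps *)

(** Invertibility of [e0] modulo p. The coefficient [a] is a residue modulo p, hence a natural
    number, because it becomes the exponent in [lead_exp]; [b] may be negative. *)
Lemma prime_bezout (p : nat) (e0 e : int) : prime p -> ~~ (p %| e0)%Z ->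
  exists (a : nat) (b : int), e = e0 * a%:Z + b * p%:Z.
Proof.
move=> p_pr pNe0; have p_gt0 := prime_gt0 p_pr.
have /coprimezP[[u v] /= uv] : coprimez p%:Z e0 by rewrite coprimezE prime_coprime.
exists `|(v * e %% p)%Z|%N, (e * u + (v * e %/ p)%Z * e0).
rewrite gez0_abs ?modz_ge0 //; last by lia.
have -> : (v * e %% p)%Z = v * e - (v * e %/ p)%Z * p%:Z by [].
by rewrite -[LHS]mulr1 -uv; ring.
Qed.

Section Jump.
Variables (k K : fieldType) (iota : {rmorphism k -> K}) (v : K -> int).
Hypothesis Kv : valuation iota v.
Variable tau : {rmorphism K -> K}.
Hypotheses (v_tau : forall x : K, x != 0 -> v (tau x) = v x).
Hypotheses (tau_iota : forall c, tau (iota c) = iota c).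
Local Notation vge := (val_ge v).
Implicit Types (x y f g h : K) (c : k) (m : int).

Lemma val_ge_tau m x : vge m (tau x) = vge m x.
Proof.
have [->|x0] := eqVneq x 0; first by rewrite rmorph0.
by rewrite !val_ge_neq0 ?fmorph_eq0 // v_tau.
Qed.

(** The elements f for which (tau f - f) / f has valuation at least m are closed under products and
    inverses. *)
Lemma val_twist_exp m f (e : int) : f != 0 -> vge (v f + m) (tau f - f) ->
  vge (v (f ^ e) + m) (tau (f ^ e) - f ^ e).
Proof.
move=> f0 fm; have nat_exp (i : nat) : vge (v (f ^+ i) + m) (tau (f ^+ i) - f ^+ i).
  elim: i => [|i IHi]; first by rewrite rmorph1 subrr val_ge0.
  have -> : tau (f ^+ i.+1) - f ^+ i.+1 =
      (tau f - f) * tau (f ^+ i) + f * (tau (f ^+ i) - f ^+ i).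
    by rewrite exprS rmorphM; ring.
  rewrite exprS (valM Kv) ?expf_neq0 //; apply: (val_geD Kv).
    by rewrite addrAC; apply: (val_geM Kv); rewrite ?val_ge_tau ?val_ge_val.
  by rewrite -addrA; apply: (val_geM Kv); rewrite ?val_ge_val.
case: e => i; first exact: nat_exp.
rewrite NegzE -exprnN; move: (f ^+ _) (nat_exp i.+1) (expf_neq0 i.+1 f0) => g gm g0.
have tg0 : tau g != 0 by rewrite fmorph_eq0.
have -> : tau g^-1 - g^-1 = - (g^-1 * (tau g)^-1 * (tau g - g)).
  by rewrite fmorphV; field; rewrite tg0.
apply: (val_geN Kv); rewrite (valV Kv) //.
have -> : - v g + m = - v g + - v g + (v g + m) by ring.
apply: (val_geM Kv) gm; apply: (val_geM Kv); rewrite -(valV Kv) //.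
  exact: val_ge_val.
by rewrite -fmorphV val_ge_tau val_ge_val.
Qed.

Section Approximation.
Variable S : divringClosed K.
Hypothesis S_iota : forall c, iota c \in S.

(** One test element g per valuation suffices: f = c g + h with c a constant fixed by [tau] and h of
    larger valuation, to which the argument applies again. *)
Lemma val_approx d :
    {in S, forall f, f != 0 -> exists2 g, g \in S &
      [/\ g != 0, v g = v f & vge (v g + d) (tau g - g)]} ->
  {in S, forall f, f != 0 -> vge (v f + d) (tau f - f)}.
Proof.
move=> hS f fS f0.
(* [N] bounds how far the target [m] exceeds [v f]. For [N = 0] the target is met because [tau]
   preserves valuations; passing to the remainder h lowers [N]. *)
suff H N : forall m f, f \in S -> f != 0 -> m <= v f + N%:Z -> m <= v f + d ->
    vge m (tau f - f).
  by apply: (H `|d|%N) => //; lia.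
elim: N => [|N IHN] {f fS f0} m f fS f0 le_mN le_md.
  by apply: (val_geB Kv); rewrite ?val_ge_tau val_ge_neq0 //; lia.
have [g gS [g0 vg gd]] := hS f fS f0.
have [c c0 [h fh fE]] := val_split Kv f0 g0 (esym vg).
have -> : tau f - f = iota c * (tau g - g) + (tau h - h).
  by rewrite fE rmorphD rmorphM tau_iota; ring.
apply: (val_geD Kv); first by apply: (val_geZ Kv); apply: val_ge_le gd; rewrite vg.
have [->|h0] := eqVneq h 0; first by rewrite rmorph0 subrr val_ge0.
have hhS : h \in S by rewrite -(addKr (iota c * g) h) -fE rpredD ?rpredN ?rpredM.
rewrite val_ge_neq0 // in fh; apply: IHN => //; clear -fh le_mN le_md; lia.
Qed.

End Approximation.

Variables (p : nat) (p_char : p \in [pchar k]).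

(** * Leading coefficients of (tau f - f) / f *)

Section Leading.
Variables (d : int) (P : K).
Hypotheses (d_gt0 : 0 < d) (P0 : P != 0) (vP : v P = d).
(** The quotient (tau f - f) / f has leading term c P, where P has valuation d; c = 0 means that its
    valuation exceeds d. *)
Local Notation lead f c := (vge (v f + d + 1) (tau f - f - iota c * (P * f))).

Lemma val_ge_td c f m : m <= v f + d -> vge m (iota c * (P * f)).
Proof.
move=> le_m; apply: (val_geZ Kv); apply: val_ge_le le_m _; rewrite addrC.
by apply: (val_geM Kv) (val_ge_val _ _); rewrite -vP val_ge_val.
Qed.

Lemma lead_ge f c : lead f c -> vge (v f + d) (tau f - f).
Proof.
move=> fc; rewrite -[tau f - f](subrK (iota c * (P * f))).
by apply: (val_geD Kv); [apply: val_ge_le fc; lia|apply: val_ge_td].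
Qed.

Lemma lead_gt f c : f != 0 -> lead f c -> vge (v f + d + 1) (tau f - f) = (c == 0).
Proof.
move=> f0 fc; apply/idP/eqP => [fgt|c0]; last first.
  by move: fc; rewrite c0 rmorph0 mul0r subr0.
apply: contraTeq isT => c0; have: vge (v f + d + 1) (iota c * (P * f)).
  by have := val_geB Kv fgt fc; rewrite subKr.
rewrite (val_ge_scaled Kv) // val_ge_neq0 ?mulf_neq0 //.
by rewrite (valM Kv) // vP; lia.
Qed.

(** The leading coefficient behaves like a logarithmic derivative. The cross term has valuation at
    least v f + v g + 2 d, which is negligible because d > 0. *)
Lemma lead_mul f g b c : f != 0 -> g != 0 ->
  lead f b -> lead g c -> lead (f * g) (b + c).
Proof.
move=> f0 g0 fb gc; rewrite (valM Kv) // rmorphM.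
have -> : tau f * tau g - f * g - iota (b + c) * (P * (f * g)) =
  (tau f - f - iota b * (P * f)) * tau g + f * (tau g - g - iota c * (P * g))
   + (iota b * (P * f)) * (tau g - g).
  by rewrite rmorphD; ring.
have glead := lead_ge gc.
apply: (val_geD Kv); first apply: (val_geD Kv).
- apply: (@val_ge_le _ v _ ((v f + d + 1) + v g)); first by lia.
  by apply: (val_geM Kv); rewrite ?val_ge_tau ?val_ge_val.
- apply: (@val_ge_le _ v _ (v f + (v g + d + 1))); first by lia.
  by apply: (val_geM Kv); rewrite ?val_ge_val.
- apply: (@val_ge_le _ v _ ((v f + d) + (v g + d))); first by lia.
  by apply: (val_geM Kv) => //; apply: val_ge_td.
Qed.

Lemma lead_exp f c a : f != 0 -> lead f c -> lead (f ^+ a) (a%:R * c).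
Proof.
move=> f0 fc; elim: a => [|a IHa].
  by rewrite expr0 rmorph1 subrr mul0r rmorph0 mul0r subrr val_ge0.
by rewrite exprS -nat1r mulrDl mul1r; apply: lead_mul; rewrite ?expf_neq0.
Qed.

(** In characteristic p, [tau - 1] commutes with p-th powers, so a gain of m in valuation becomes a
    gain of p m, which exceeds d. *)
Lemma lead_frob f m : f != 0 -> d < p%:Z * m -> vge (v f + m) (tau f - f) ->
  lead (f ^+ p) 0.
Proof.
move=> f0 dm fm; rewrite rmorph0 mul0r subr0 rmorphXn.
have -> : tau f ^+ p - f ^+ p = (tau f - f) ^+ p.
  have pK := rmorph_pchar iota p_char.
  by rewrite -!(pFrobenius_autE pK) pFrobenius_autB_comm //; apply: mulrC.
by apply: val_ge_le (val_geX Kv p fm); rewrite (valX Kv) //; nia.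
Qed.

Lemma lead_approx f g h c : f = g + h -> v g = v f -> vge (v f + 1) h ->
  vge (v f + d + 1) (tau h - h) -> lead g c -> lead f c.
Proof.
move=> fE vg fh hgt; rewrite vg => gc.
have -> : tau f - f - iota c * (P * f) = (tau g - g - iota c * (P * g))
   + (tau h - h) - iota c * (P * h) by rewrite fE rmorphD; ring.
apply: (val_geB Kv); first exact: (val_geD Kv).
have [->|h0] := eqVneq h 0; first by rewrite !mulr0 val_ge0.
by apply: val_ge_td; rewrite val_ge_neq0 // in fh; clear -fh; lia.
Qed.

End Leading.

(** S is meant to have value group q Z. The second clause equates two booleans; since 0 satisfies
    every [val_ge] bound, it also forces p q to divide the valuation of every nonzero f in S fixed
    by [tau]. *)
Definition jumps (q d : int) (S : {pred K}) := {in S, forall f, f != 0 ->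
  vge (v f + d) (tau f - f) /\
  vge (v f + d + 1) (tau f - f) = (p%:Z * q %| v f)%Z}.

(** One element y with p not dividing [e0] and gain exactly d controls all of S: each valuation is
    attained by some y^a (u^i)^p, whose second factor contributes nothing by [lead_frob]. The
    leading coefficient is thus a times that of y, and vanishes exactly when p divides a. *)
Lemma jumps_gen (S : divringClosed K) (q d e0 m : int) (t u y : K) :
  t != 0 -> v t = 1 -> (forall c, iota c \in S) ->
  0 < q -> 0 < d -> d < p%:Z * m ->
  {in S, forall f, f != 0 -> (q %| v f)%Z} ->
  {in S, forall f, f != 0 -> vge (v f + m) (tau f - f)} ->
  u \in S -> u != 0 -> v u = q ->
  y \in S -> y != 0 -> v y = e0 * q -> ~~ (p %| e0)%Z ->
  vge (v y + d) (tau y - y) -> ~~ vge (v y + d + 1) (tau y - y) ->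
  jumps q d S.
Proof.
move=> t0 vt S_iota q_gt0 d_gt0 dm Sq Sm uS u0 vu yS y0 vy e0p yd yd'.
have p_pr : prime p := pcharf_prime p_char.
have P0 : t ^ d != 0 by apply: expfz_neq0.
have vP : v (t ^ d) = d by rewrite (valXz Kv) // vt mul1r.
move: (t ^ d) P0 vP => P P0 vP.
have [b b0 yb] : exists2 b, b != 0 &
    vge (v y + d + 1) (tau y - y - iota b * (P * y)).
  have ty0 : tau y - y != 0 by apply: contraNneq yd' => ->; rewrite val_ge0.
  have vty : v (tau y - y) = v y + d.
    by rewrite !val_ge_neq0 // in yd yd'; clear -yd yd'; lia.
  have z0 : P * y != 0 by rewrite mulf_neq0.
  have [|b b0] := val_lead Kv ty0 z0.
    by rewrite vty (valM Kv) // vP addrC.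
  by rewrite vty; exists b.
have gen f : f \in S -> f != 0 -> exists2 g, g \in S & exists a : nat,
    [/\ g != 0, v g = v f, vge (v g + d + 1) (tau g - g - iota (a%:R * b) * (P * g))
      & (p %| a)%N = (p%:Z * q %| v f)%Z].
  move=> fS f0; have /dvdzP[e ve] := Sq f fS f0.
  have [a [i ei]] := prime_bezout e p_pr e0p.
  have ui0 : u ^ i != 0 by rewrite expfz_neq0.
  have uiS : u ^ i \in S by apply: rpredXz.
  exists (y ^+ a * (u ^ i) ^+ p); first by rewrite rpredM ?rpredX.
  exists a; split.
  - by rewrite mulf_neq0 ?expf_neq0.
  - rewrite (valM Kv) ?expf_neq0 // !(valX Kv) // (valXz Kv) // vu vy ve ei; ring.
  - rewrite -[a%:R * b]addr0; apply: lead_mul => //; rewrite ?expf_neq0 //.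
      exact: lead_exp.
    by apply: lead_frob (Sm _ _ _).
  have q0 : q != 0 by rewrite gt_eqF.
  rewrite ve dvdz_mul2r // ei.
  have pe0 : coprimez p%:Z e0 by rewrite coprimezE prime_coprime.
  rewrite rpredDr; last exact: dvdz_mull.
  by rewrite Gauss_dvdzr.
(* The lower bound on all of S comes first, because comparing f with c g below needs it for the
   remainder h. *)
have weak : {in S, forall f, f != 0 -> vge (v f + d) (tau f - f)}.
  apply: (val_approx S_iota) => f fS f0; have [g gS [a [g0 vg gl _]]] := gen f fS f0.
  by exists g => //; split=> //; apply: lead_ge gl.
move=> f fS f0; split; first exact: weak.
have [g gS [a [g0 vg gl <-]]] := gen f fS f0.
have [c c0 [h fh fE]] := val_split Kv f0 g0 (esym vg).
have vcg : v (iota c * g) = v f by rewrite (valZ Kv).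
have cl : vge (v (iota c * g) + d + 1)
    (tau (iota c * g) - iota c * g - iota (a%:R * b) * (P * (iota c * g))).
  rewrite vcg -vg; set l := iota (a%:R * b).
  have -> : tau (iota c * g) - iota c * g - l * (P * (iota c * g)) =
    iota c * (tau g - g - l * (P * g)) by rewrite rmorphM tau_iota; ring.
  exact: (val_geZ Kv).
have fl : vge (v f + d + 1) (tau f - f - iota (a%:R * b) * (P * f)).
  apply: (lead_approx vP fE vcg fh _ cl).
  have [->|h0] := eqVneq h 0; first by rewrite rmorph0 subrr val_ge0.
  have hS : h \in S by rewrite -(addKr (iota c * g) h) -fE rpredD ?rpredN ?rpredM.
  by apply: val_ge_le (weak _ hS h0); rewrite val_ge_neq0 // in fh; clear -fh; lia.
rewrite (lead_gt d_gt0 P0 vP f0 fl) mulf_eq0 (negPf b0) orbF.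
exact/esym/dvdn_pcharf.
Qed.

End Jump.

(** * The p-th power of tau - 1 and the roots of X^p - X *)

Section Twist.
Variables (K : fieldType) (tau : {rmorphism K -> K}).
Local Notation D := (fun f => tau f - f).

(** Binomial expansion of tau = 1 + D. *)
Lemma iter_twist m f :
  iter m tau f = \sum_(i < m.+1) iter i D f *+ 'C(m, i).
Proof.
elim: m => [|m IHm]; first by rewrite big_ord1 /= bin0.
rewrite iterS IHm rmorph_sum /=.
transitivity (\sum_(i < m.+1) (iter i D f *+ 'C(m, i) + iter i.+1 D f *+ 'C(m, i))).
  by apply: eq_bigr => i _; rewrite rmorphMn /= -mulrnDl addrC subrK.
rewrite big_split /= [RHS]big_ord_recl /= bin0.
under [X in _ = _ + X]eq_bigr do rewrite /bump add1n binS mulrnDr.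
rewrite big_split /= [X in _ = _ + (X + _)]big_ord_recr /= bin_small // mulr0n addr0 addrA.
by rewrite [X in X + _ = _]big_ord_recl /= bin0.
Qed.

(** The inner binomial coefficients vanish in characteristic p. For [tau] of order p this makes D
    nilpotent. *)
Lemma iter_twist_pchar p f : p \in [pchar K] -> iter p D f = iter p tau f - f.
Proof.
case: p => [|p] pK; have p_pr := pcharf_prime pK; first by [].
rewrite iter_twist big_ord_recl big_ord_recr /= /bump add1n bin0 binn !mulr1n.
rewrite big1 ?add0r => [|i _]; first by rewrite addrAC subrr add0r.
rewrite add1n -mulr_natr.
have /(prime_dvd_bin p_pr) : (0 < i.+1 < p.+1)%N by have := ltn_ord i; lia.
by rewrite (dvdn_pcharf pK) => /eqP ->; rewrite mulr0.
Qed.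

End Twist.

(** Otherwise c and the images of 0, ..., p - 1 would be p + 1 distinct roots of X^p - X. The form c
    + i = 0 lets the i-th power of [x] cancel the constant c in [level_step]. *)
Lemma frob_fixed (k : fieldType) (p : nat) (c : k) : p \in [pchar k] ->
  c ^+ p = c -> exists i : nat, c + i%:R = 0.
Proof.
move=> pk cp; have p_pr := pcharf_prime pk; apply: contrapT => no_i.
have XB : ('X^p - 'X : {poly k}) != 0.
  apply/eqP => /(congr1 (fun q : {poly k} => q`_1)).
  rewrite coefB coefXn coefX coef0 /=; case: eqP => [p1|_].
    by move: p_pr; rewrite -p1.
  by move/eqP; rewrite sub0r oppr_eq0 oner_eq0.
have sXB : size ('X^p - 'X : {poly k}) = p.+1.
  by rewrite size_polyDl ?size_polyXn // size_polyN size_polyX ltnS prime_gt1.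
pose r := c :: [seq i%:R : k | i <- iota 0 p].
have : (size r < size ('X^p - 'X : {poly k})%R)%N.
  apply: max_poly_roots => //=; first (apply/andP; split).
  - by rewrite rootE !hornerE cp subrr.
  - apply/allP => _ /mapP[i _ ->]; rewrite rootE !hornerE.
    by rewrite -(pFrobenius_autE pk) pFrobenius_aut_nat subrr.
  apply/andP; split.
    apply/mapP => -[i]; rewrite mem_iota => /andP[_ lt_ip] ci.
    by apply: no_i; exists (p - i)%N; rewrite ci -natrD subnKC ?(pcharf0 pk) // ltnW.
  rewrite map_inj_in_uniq ?iota_uniq // => i j.
  rewrite !mem_iota => ip jp /eqP; wlog le_ij : i j ip jp / (i <= j)%N => [W|].
    have [ij|ji] := leqP i j; first exact: W.
    by rewrite eq_sym => /(W _ _ jp ip (ltnW ji)).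
  rewrite eq_sym -subr_eq0 -natrB // -(dvdn_pcharf pk).
  by rewrite /dvdn modn_small; lia.
by rewrite sXB /= size_map size_iota ltnn.
Qed.

(** * Towers of fixed fields *)

Section Tower.
Variables (k K : fieldType) (iota : {rmorphism k -> K}) (v : K -> int) (t : K).
Hypotheses (Kv : valuation iota v) (t0 : t != 0) (vt : v t = 1).
Variables (p : nat) (p_char : p \in [pchar k]).
Variables (H : finGroupType) (sigma : H -> {rmorphism K -> K}).
Hypotheses (sigma1 : sigma 1%g =1 id)
  (sigmaM : forall g h, sigma (g * h)%g =1 sigma g \o sigma h)
  (sigma_iota : forall g c, sigma g (iota c) = iota c)
  (v_sigma : forall g (x : K), x != 0 -> v (sigma g x) = v x)
  (H_abelian : forall g h : H, commute g h)
  (H_exponent : forall g : H, (g ^+ p = 1)%g).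
Local Notation vge := (val_ge v).
Implicit Types (f g : K) (G : {group H}) (x : H).

Let p_prime : prime p := pcharf_prime p_char.

Definition fixed (G : {set H}) : {pred K} :=
  fun f => [forall x in G, sigma x f == f].

Lemma fixedP (G : {set H}) f :
  reflect (forall x, x \in G -> sigma x f = f) (f \in fixed G).
Proof. by apply: (iffP forall_inP) => h x /h; [move/eqP | move=> ->]. Qed.

Fact fixed_divring_closed (G : {set H}) : GRing.divring_closed (fixed G).
Proof.
split=> [|f g /fixedP fG /fixedP gG|f g /fixedP fG /fixedP gG].
- by apply/fixedP => x _; rewrite rmorph1.
- by apply/fixedP => x xG; rewrite rmorphB fG ?gG.
- by apply/fixedP => x xG; rewrite fmorph_div fG ?gG.
Qed.
HB.instance Definition _ (G : {set H}) :=
  GRing.isDivringClosed.Build K (fixed G) (fixed_divring_closed G).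

Lemma fixed_iota (G : {set H}) c : iota c \in fixed G.
Proof. by apply/fixedP => x _; rewrite sigma_iota. Qed.

Lemma fixedS (G G' : {set H}) : G \subset G' -> {subset fixed G' <= fixed G}.
Proof. by move=> /subsetP GG' f /fixedP fG'; apply/fixedP => x /GG' /fG'. Qed.

Lemma fixed_sigma (G : {set H}) x f : f \in fixed G -> sigma x f \in fixed G.
Proof.
move=> /fixedP fG; apply/fixedP => y yG.
by rewrite -[LHS](sigmaM y x f) H_abelian sigmaM /= fG.
Qed.

Lemma sigmaX x (i : nat) f : sigma (x ^+ i)%g f = iter i (sigma x) f.
Proof. by elim: i => [|i IHi]; rewrite ?sigma1 // expgS sigmaM /= IHi. Qed.

(* The fixed field of G is a local field with value group q Z, on which H / G
   acts with the single ramification jump n. *)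
Record level (n q : int) (G : {set H}) : Prop := Level {
  level_gt0 : 0 < q;
  level_dvd : {in fixed G, forall f, f != 0 -> (q %| v f)%Z};
  level_unif : exists2 u, u \in fixed G & u != 0 /\ v u = q;
  level_jump : forall x, x \notin G -> jumps v (sigma x) p q (q * n) (fixed G) }.

(** * The bottom level, and p does not divide n *)

Section Base.
Variables (n : int).
Hypotheses (n_gt0 : 0 < n)
  (t_jump : forall x, x != 1%g ->
     vge (n + 1) (sigma x t - t) /\ ~~ vge (n + 2) (sigma x t - t)).

(** Powers of t realise all valuations and inherit the bound known for t, which [val_approx] extends
    to K. Then [jumps_gen] applies with y = u = t and m = n. *)
Lemma level_base : level n 1 [1 H]%g.
Proof.
have tS : t \in fixed [1 H]%g by apply/fixedP => x /set1P ->; rewrite sigma1.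
split=> //; first by exists t.
move=> x; rewrite inE => /t_jump[tge tlt].
have weak : {in fixed [1 H]%g, forall f, f != 0 -> vge (v f + n) (sigma x f - f)}.
  apply: (val_approx Kv (v_sigma x) (sigma_iota x) (fixed_iota _)) => f fS f0.
  exists (t ^ v f); first exact: rpredXz.
  split; rewrite ?expfz_neq0 //; first by rewrite (valXz Kv) // vt mul1r.
  by apply: (val_twist_exp Kv (v_sigma x)) => //; rewrite vt addrC.
apply: (jumps_gen Kv (v_sigma x) (sigma_iota x) p_char (e0 := 1)
  t0 vt (fixed_iota _) _ _ _ _ weak tS t0 vt tS t0) => //; rewrite ?mul1r //.
- by have := prime_gt1 p_prime; nia.
- by rewrite dvdz1 /=; have := prime_gt1 p_prime; lia.
- by rewrite vt addrC.
- by rewrite vt [1 + n]addrC -addrA.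
Qed.

(** If p divided n, the iterates D^j t would have valuations 1 + j n, all prime to p, so none could
    vanish; but D^p = sigma (x^p) - 1 = 0. *)
Lemma jump_ndvd : (exists x : H, x != 1%g) -> ~~ (p %| n)%Z.
Proof.
move=> [x x1]; apply/negP => pn.
have x1' : x \notin [1 H]%g by rewrite inE.
have [_ _ _ /(_ x x1') jx] := level_base.
have itz (j : nat) : let z := iter j (fun f => sigma x f - f) t in
    z != 0 /\ v z = 1 + j%:Z * n.
  elim: j => [|j [z0 vz]] /=; first by rewrite mul0r addr0.
  set z := iter j _ _ in z0 vz *.
  have zS : z \in fixed [1 H]%g by apply/fixedP => y /set1P ->; rewrite sigma1.
  have [zge zlt] := jx _ zS z0.
  have pz : (p%:Z * 1 %| v z)%Z = false.
    rewrite mulr1 vz; apply/negP => pz.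
    have : (p %| 1)%Z by rewrite -(rpredDr _ (dvdz_mull j%:Z pn)).
    by rewrite dvdz1 /=; have := prime_gt1 p_prime; lia.
  have z10 : sigma x z - z != 0 by apply: contraFneq pz => E; rewrite -zlt E val_ge0.
  split=> //; rewrite pz in zlt; rewrite !val_ge_neq0 // in zge zlt.
  by rewrite mul1r in zge zlt; rewrite vz in zge zlt; clear -zge zlt; lia.
have [] := itz p; rewrite (iter_twist_pchar _ _ (rmorph_pchar iota p_char)).
by rewrite -sigmaX H_exponent sigma1 subrr eqxx.
Qed.

End Base.

Section Step.
Variables (n q : int) (G : {set H}) (G' : {group H}) (x : H).
Hypotheses (n_gt0 : 0 < n) (pn : ~~ (p %| n)%Z) (lG : level n q G).
Hypotheses (GG' : G \subset G') (xG' : x \in G') (xG : x \notin G).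
Hypothesis fixG' : {in fixed G, forall f, sigma x f = f -> f \in fixed G'}.

(* Start from a power of the uniformizer whose valuation, divided by q, is
   congruent to n modulo p: then sigma x - 1 raises the valuation by exactly
   q n each time it is applied, except for the p-th time, when it gives 0. *)
Lemma artin_schreier_gen : exists w b : K,
  [/\ w \in fixed G, w != 0, v w = - n * q & sigma x w = w + 1] /\
  [/\ b \in fixed G', b != 0 & v b = p%:Z * q].
Proof.
have [q_gt0 qdvd [u uS [u0 vu]] /(_ x xG) jx] := lG.
have p_gt1 := prime_gt1 p_prime.
(* This m gives D^(p-2) (u^m) and D^(p-1) (u^m) the valuations (p - n) q and p q. *)
pose D := (fun f => sigma x f - f); pose m := p%:Z - (p%:Z - 1) * n.
have itz (j : nat) : (j < p)%N -> let z := iter j D (u ^ m) in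
    [/\ z \in fixed G, z != 0 & v z = (m + j%:Z * n) * q].
  elim: j => [|j IHj] lt_jp.
    rewrite /= mul0r addr0 expfz_neq0 // (valXz Kv) // vu mulrC; split=> //.
    exact: rpredXz.
  have [zS z0 vz] := IHj (ltnW lt_jp); rewrite iterS.
  set z := iter j _ _ in zS z0 vz *; have [zge zlt] := jx _ zS z0.
  (* Modulo p, m + j n is (j + 1) n, and 0 < j + 1 < p. *)
  have pz : (p%:Z * q %| v z)%Z = false.
    rewrite vz dvdz_mul2r ?gt_eqF //; apply/negP => pz.
    have : (p%:Z %| j.+1%:Z * n)%Z.
      have -> : j.+1%:Z * n = (m + j%:Z * n) - (1 - n) * p%:Z by rewrite /m intS; ring.
      by rewrite rpredB // dvdz_mull.
    rewrite Gauss_dvdzl; last by rewrite coprimezE prime_coprime.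
    by rewrite dvdzE /= gtnNdvd.
  have z10 : D z != 0 by apply: contraFneq pz => E; rewrite -zlt /= [X in vge _ X]E val_ge0.
  split=> //; first by rewrite rpredB // fixed_sigma.
  rewrite pz in zlt; rewrite !val_ge_neq0 // in zge zlt.
  have -> : v (D z) = v z + q * n by rewrite -/(D z) in zge zlt; clear -zge zlt; lia.
  by rewrite vz intS; ring.
have [p' pE] : exists p', p = p'.+2 by exists p.-2; clear -p_gt1; lia.
have [|aS a0 va] := itz p'; first by rewrite pE.
have [|bS b0 vb] := itz p'.+1; first by rewrite pE.
have Db : D (iter p'.+1 D (u ^ m)) = 0.
  rewrite -[LHS]/(iter p'.+2 D (u ^ m)) -pE.
  rewrite (iter_twist_pchar _ _ (rmorph_pchar iota p_char)).
  by rewrite -sigmaX H_exponent sigma1 subrr.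
rewrite iterS in bS b0 vb Db; set a := iter p' _ _ in aS a0 va bS b0 vb Db.
set b := D a in bS b0 vb Db.
have xb : sigma x b = b by apply/eqP; rewrite -subr_eq0; apply/eqP.
have xa : sigma x a = a + b by rewrite addrC subrK.
(* As b is fixed and sigma x a = a + b, the quotient a / b is moved by 1. *)
exists (a / b), b; split; split=> //.
- by rewrite rpred_div.
- by rewrite mulf_neq0 ?invr_eq0.
- rewrite (valM Kv) ?invr_eq0 // (valV Kv) // va vb /m pE !intS; ring.
- by rewrite fmorph_div xb xa mulrDl divff.
- exact: fixG'.
- by rewrite vb /m pE !intS; ring.
Qed.

(** The Artin-Schreier element y = w^p - w is fixed by x and has valuation -n p q. For z outside G',
    sigma z w - w is a unit with residue c, and sigma z y - y has leading constant c^p - c. This is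
    nonzero since c is not in the prime field, so y has gain exactly p q n and [jumps_gen] applies
    with the uniformizer b. *)
Lemma level_step : level n (p%:Z * q) G'.
Proof.
have [w [b [[wS w0 vw xw] [bS b0 vb]]]] := artin_schreier_gen.
have [q_gt0 qdvd _ jG] := lG.
have p_gt1 := prime_gt1 p_prime.
have pK := rmorph_pchar iota p_char.
have frobD (y z : K) : (y + z) ^+ p = y ^+ p + z ^+ p.
  by rewrite -!(pFrobenius_autE pK) pFrobenius_autD_comm //; apply: mulrC.
have frobB (y z : K) : (y - z) ^+ p = y ^+ p - z ^+ p.
  by rewrite -!(pFrobenius_autE pK) pFrobenius_autB_comm //; apply: mulrC.
have sub := fixedS GG'.
have dvd' : {in fixed G', forall f, f != 0 -> (p%:Z * q %| v f)%Z}.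
  move=> f fS f0; have [_ <-] := jG x xG f (sub f fS) f0.
  by move/fixedP: fS => /(_ x xG') ->; rewrite subrr val_ge0.
pose y := w ^+ p - w.
have yS : y \in fixed G'.
  apply: fixG'; first by rewrite rpredB ?rpredX.
  by rewrite rmorphB rmorphXn xw frobD expr1n /y; ring.
have [y0 vy] : y != 0 /\ v y = - n * (p%:Z * q).
  have [|||y0 vy] := @val_addl _ _ _ _ Kv (w ^+ p) (- w) (- n * q).
  - by rewrite expf_neq0.
  - by rewrite (valX Kv) // vw; clear -n_gt0 q_gt0 p_gt1; nia.
  - by apply: (val_geN Kv); rewrite -vw val_ge_val.
  by split; rewrite // vy (valX Kv) // vw; ring.
have nG' (z g : H) : z \notin G' -> g \in G' -> (z * g)%g \notin G.
  by move=> zG' gG'; apply: contra zG' => /(subsetP GG'); rewrite groupMr.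
split; first by rewrite mulr_gt0 //; clear -p_gt1; lia.
- exact: dvd'.
- by exists b.
move=> z zG'; have zG : z \notin G by rewrite -[z]mulg1 nG' ?group1.
have pv_w : (p%:Z * q %| v w)%Z = false.
  by rewrite vw dvdz_mul2r ?gt_eqF // dvdzE abszN -dvdzE (negPf pn).
have jw (g : H) : g \notin G -> sigma g w - w != 0 /\ v (sigma g w - w) = 0.
  move=> gG; have [wge wlt] := jG g gG w wS w0; rewrite pv_w in wlt.
  have e0 : sigma g w - w != 0 by apply: contraFneq wlt => ->; rewrite val_ge0.
  split=> //; rewrite !val_ge_neq0 // vw in wge wlt.
  by clear -wge wlt; lia.
have [e0 ve] := jw z zG; have [c c0 eh] := val_residue Kv e0 ve.
set e := sigma z w - w in e0 ve eh; set h := e - iota c in eh.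
have zw : sigma z w = w + e by rewrite addrC subrK.
(* If c were in the prime field, multiplying z by a power of x would give an
   element outside G that moves w by less than the jump allows. *)
have cp : c ^+ p != c.
  apply/eqP => /(frob_fixed p_char)[i ci].
  have xiG : (x ^+ i)%g \in G' by rewrite groupX.
  have xiw : sigma (x ^+ i)%g w = w + i%:R.
    rewrite sigmaX; elim: (i) => [|j IHj]; first by rewrite addr0.
    by rewrite iterS IHj rmorphD rmorph_nat xw -addrA nat1r.
  have [] := jw _ (nG' z _ zG' xiG).
  have -> : sigma (z * x ^+ i)%g w - w = h.
    rewrite sigmaM /= xiw rmorphD rmorph_nat zw /h.
    have -> : iota c = - i%:R.
      by apply/eqP; rewrite -addr_eq0 -(rmorph_nat iota) -rmorphD ci rmorph0.
    ring.
  by move=> h0 vh; rewrite val_ge_neq0 // vh in eh.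
have yz : sigma z y - y = iota (c ^+ p - c) + (h ^+ p - h).
  rewrite /y rmorphB rmorphXn zw frobD rmorphB rmorphXn /h [(e - iota c) ^+ p]frobB; ring.
have hh : vge 1 (h ^+ p - h).
  apply: (val_geB Kv) => //; apply: val_ge_le (val_geX Kv p eh).
  by clear -p_gt1; lia.
have vd0 : v y + p%:Z * q * n = 0 by rewrite vy; ring.
(* Valuations on [fixed G'] are divisible by p q, so the jump at level G improves the bound q n to m
   = q n + 1, and p m > p q n. *)
apply: (jumps_gen Kv (v_sigma z) (sigma_iota z) p_char (m := q * n + 1) t0 vt
  (fixed_iota _) _ _ _ dvd' _ bS b0 vb yS y0 vy).
- by rewrite mulr_gt0 //; clear -p_gt1; lia.
- by rewrite !mulr_gt0 //; clear -p_gt1; lia.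
- by clear -p_gt1 n_gt0 q_gt0; rewrite mulrDr mulrA; lia.
- move=> f fS f0; have [_ E] := jG z zG f (sub f fS) f0.
  by rewrite addrA E dvd'.
- by rewrite dvdzE abszN -dvdzE.
- rewrite vd0 yz; apply: (val_geD Kv); first exact: val_ge_const Kv _.
  by apply: val_ge_le hh.
rewrite vd0 add0r yz; apply/negP => /(val_geB Kv)/(_ hh).
have cc : c ^+ p - c != 0 by rewrite subr_eq0.
by rewrite addrK val_ge_neq0 ?fmorph_eq0 // (val_const Kv).
Qed.

End Step.

Lemma fixed_gen (A : {set H}) f : f \in fixed A -> f \in fixed <<A>>%g.
Proof.
move=> /fixedP fA; pose S := [set g | sigma g f == f].
have gS : group_set S.
  apply/group_setP; split=> [|g h]; first by rewrite inE sigma1.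
  by rewrite !inE sigmaM /= => /eqP gf /eqP ->; apply/eqP.
have : <<A>>%g \subset Group gS.
  by rewrite gen_subG; apply/subsetP => g gA; rewrite inE fA.
by move=> /subsetP AS; apply/fixedP => g /AS; rewrite inE => /eqP.
Qed.

Lemma level_tower (n : int) (s : nat) (G : nat -> {group H}) (x : nat -> H) :
  0 < n -> ~~ (p %| n)%Z -> level n 1 (G 0) ->
  (forall i, (i < s)%N -> x i \notin G i /\ G i.+1 = <<x i |: G i>>%G) ->
  forall i, (i <= s)%N -> level n (p ^ i)%:Z (G i).
Proof.
move=> n_gt0 pn l0 Gx; elim=> [|i IHi] lt_is; first by rewrite expn0.
have [xG GE] := Gx i lt_is; rewrite expnS PoszM.
have GG' : x i |: G i \subset G i.+1 by rewrite GE subset_gen.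
apply: (level_step n_gt0 pn (IHi (ltnW lt_is)) _ _ xG).
- by apply: subset_trans GG'; apply: subsetUr.
- by apply: (subsetP GG'); rewrite setU11.
move=> f /fixedP fG xf; rewrite GE; apply: fixed_gen; apply/fixedP => g.
by rewrite !inE => /predU1P[->//|/fG].
Qed.

Lemma level_span (n q a : int) (G : {set H}) (G' : {group H}) (x : H) (u : K)
    (R : K -> Prop) :
  level n q G -> level n (p%:Z * q) G' -> G \subset G' -> x \in G' -> x \notin G ->
  u \in fixed G -> u != 0 -> v u = q ->
  (forall f g, R f -> R g -> R (f + g)) ->
  (forall f, vge a f -> R f) ->
  (forall c e, ~~ (p %| e)%Z -> a - q * n <= q * e < a -> R (iota c * u ^ e)) ->
  {in fixed G, forall f, vge a (sigma x f - f) ->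
    exists2 r, R r & exists2 g, g \in fixed G' & f = r + g}.
Proof.
move=> [q_gt0 qdvd _ jG] [_ _ [u' uS' [u0' vu']] _] GG' xG' xG uS u0 vu.
move=> RD Ra Ru f fS fx.
(* Induction on the distance of v f below a. *)
have : vge (a - `|a - v f|%N%:Z) f.
  by rewrite /val_ge; apply/orP; right; clear; lia.
move: `|_|%N => N; elim: N f fS fx => [|N IHN] f fS fx fN.
  by exists f; [apply: Ra; rewrite subr0 in fN | exists 0; rewrite ?rpred0 ?addr0].
have [fa|fa] := boolP (vge a f).
  by exists f; [apply: Ra | exists 0; rewrite ?rpred0 ?addr0].
have f0 : f != 0 by apply: contraNneq fa => ->; rewrite val_ge0.
have step z : z \in fixed G -> z != 0 -> v z = v f -> vge a (sigma x z - z) ->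
    (forall c, exists2 r, R r & exists2 g, g \in fixed G' & iota c * z = r + g) ->
    exists2 r, R r & exists2 g, g \in fixed G' & f = r + g.
  move=> zS z0 vz zx zR; have [c c0 [h fh fE]] := val_split Kv f0 z0 (esym vz).
  have [|||r Rr [g gS hE]] := IHN h.
  - by rewrite -(addKr (iota c * z) h) -fE rpredD ?rpredN ?rpredM ?fixed_iota.
  - have -> : sigma x h - h = (sigma x f - f) - iota c * (sigma x z - z).
      by rewrite fE rmorphD rmorphM sigma_iota; ring.
    by apply: (val_geB Kv) => //; apply: (val_geZ Kv).
  - by apply: val_ge_le fh; rewrite val_ge_neq0 // in fN; clear -fN; lia.
  have [r' Rr' [g' gS' zE]] := zR c.
  exists (r' + r); first exact: RD.
  by exists (g' + g); rewrite ?rpredD // fE zE hE addrACA.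
have /dvdzP[e ve] := qdvd f fS f0.
have [pe|pe] := boolP (p %| e)%Z.
  have /dvdzP[e' ee'] := pe; apply: (step (u' ^ e')).
  - exact/(fixedS GG')/rpredXz.
  - exact: expfz_neq0.
  - by rewrite (valXz Kv) // vu' ve ee'; ring.
  - by have /fixedP/(_ x xG') -> := rpredXz e' uS'; rewrite subrr val_ge0.
  move=> c; exists 0; first by apply: Ra; apply: val_ge0.
  by exists (iota c * u' ^ e'); rewrite ?add0r // rpredM ?fixed_iota // rpredXz.
have ue0 : u ^ e != 0 by apply: expfz_neq0.
have vue : v (u ^ e) = v f by rewrite (valXz Kv) // vu ve mulrC.
have pv : (p%:Z * q %| q * e)%Z = false.
  by rewrite [q * e]mulrC dvdz_mul2r ?gt_eqF // (negPf pe).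
(* Here sigma x - 1 raises the valuation of f by exactly q n, so the condition on f bounds e from
   below. *)
have ea : a - q * n <= q * e < a.
  have [_ flt] := jG x xG f fS f0; rewrite ve [e * q]mulrC pv in flt.
  rewrite val_ge_neq0 // ve [e * q]mulrC -ltNge in fa; rewrite fa andbT leNgt.
  apply/negP => lt_a; suff: false by []. rewrite -[false]flt.
  by apply: val_ge_le fx; clear -lt_a; lia.
apply: (step (u ^ e)) => //; first exact: rpredXz.
  have [zge _] := jG x xG _ (rpredXz e uS) ue0.
  by apply: val_ge_le zge; rewrite vue ve; clear -ea; lia.
move=> c; exists (iota c * u ^ e); first exact: Ru.
by exists 0; rewrite ?rpred0 ?addr0.
Qed.

(** With distinct valuations, the term of least valuation among those with nonzero coefficient
    dominates. *)
Lemma val_sum (I : finType) (b : I -> K) (c : I -> k) :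
  (forall i, b i != 0) -> injective (v \o b) -> (exists i, c i != 0) ->
  exists i, let S := \sum_i iota (c i) * b i in S != 0 /\ v S = v (b i).
Proof.
move=> b0 b_inj [i0 ci0]; pose i1 := [arg min_(i < i0 | c i != 0) v (b i)]%O.
exists i1; rewrite /i1; case: arg_minP => // i ci min_i {i1}.
rewrite (bigD1 i) //= -[in v (b i)](valZ Kv (b i) ci).
apply: (val_addl Kv (m := v (b i) + 1)).
- by rewrite mulf_neq0 ?fmorph_eq0.
- by rewrite (valZ Kv) //; clear; lia.
apply: (val_ge_sum Kv) => j ji; have [->|cj] := eqVneq (c j) 0.
  by rewrite rmorph0 mul0r val_ge0.
apply: (val_geZ Kv); rewrite val_ge_neq0 // lezD1 lt_neqAle min_i // andbT.
by apply: contra_neq ji => /b_inj.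
Qed.

(** * Generators modulo A + K^H *)

Section Decomposition.
Variables (n s : nat) (a : int) (A : nat -> int).
Hypothesis aA : forall i e, (a <= (p ^ i)%:Z * e) = (A i <= e).
Variables (G : nat -> {group H}) (x : nat -> H) (u : nat -> K).
Hypothesis G_level : forall i, (i <= s)%N -> level n%:Z (p ^ i)%:Z (G i).
Hypothesis G0 : G 0%N = 1%G.
Hypothesis GS : forall i, (i < s)%N ->
  [/\ G i \subset G i.+1, x i \in G i.+1 & x i \notin G i].
Hypothesis u_unif : forall i, (i < s)%N ->
  [/\ u i \in fixed (G i), u i != 0 & v (u i) = (p ^ i)%:Z].

Local Notation quasi f := (forall g : H, vge a (sigma g f - f)).

(* e_ (i, j) runs through the n integers just below A i = ceil (a / p ^ i), that
   is through the e such that a - p ^ i * n <= p ^ i * e < a. *)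
Let e_ (ij : 'I_s * 'I_n) : int := A ij.1 - 1 - ij.2%:Z.
Definition basis_index := {ij : 'I_s * 'I_n | ~~ (p %| e_ ij)%Z}.
Definition basis (ij : basis_index) : K := u (val ij).1 ^ e_ (val ij).

Let basis_neq0 ij : basis ij != 0.
Proof. by apply: expfz_neq0; have [] := u_unif (ltn_ord (val ij).1). Qed.

Let v_basis ij : v (basis ij) = (p ^ (val ij).1)%:Z * e_ (val ij).
Proof.
by have [_ u0 vu] := u_unif (ltn_ord (val ij).1); rewrite (valXz Kv) // vu.
Qed.

Let basis_lt ij : v (basis ij) < a.
Proof. by rewrite v_basis ltNge aA -ltNge /e_; clear; lia. Qed.

Let pX_neq0 i : (p ^ i)%:Z != 0.
Proof. by rewrite eqz_nat -lt0n expn_gt0 prime_gt0. Qed.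

(** The p-adic valuation of p^i e is i; this separates generators of different levels from each
    other and from K^H. *)
Lemma pX_dvd i j (e : int) : (i < j)%N -> ~~ (p %| e)%Z ->
  ((p ^ j)%:Z %| (p ^ i)%:Z * e)%Z = false.
Proof.
move=> lt_ij pe; apply/negP; rewrite -(subnK lt_ij) addnS -addSn expnD PoszM.
rewrite [X in (X %| _)%Z]mulrC dvdz_mul2l //; apply/negP; apply: contra pe; apply: dvdz_trans.
by rewrite expnS PoszM dvdz_mulr.
Qed.

Lemma basis_quasi ij : quasi (basis ij).
Proof.
case: ij => -[i j] pe; have [ui u0 vu] := u_unif (ltn_ord i).
have [_ _ _ jG] := G_level (ltnW (ltn_ord i)) => g.
have bS : basis (exist _ (i, j) pe) \in fixed (G i).
  exact: rpredXz.
have [gG|gG] := boolP (g \in G i).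
  by have /fixedP/(_ g gG) -> := bS; rewrite subrr val_ge0.
have [zge _] := jG g gG _ bS (basis_neq0 _); apply: val_ge_le zge.
rewrite v_basis -mulrDr aA /= /e_ /=.
by have := ltn_ord j; clear; lia.
Qed.

Lemma basis_span f : (G s : {set H}) = [set: H] -> quasi f ->
  exists c : basis_index -> k, exists2 g, g \in fixed [set: H] &
    vge a (f - g - \sum_ij iota (c ij) * basis ij).
Proof.
(* R also records quasi-invariance of r, so that the remainder g = f - r again satisfies the
   hypothesis of [level_span] at the next level. *)
move=> Gs fq; pose R r := quasi r /\
  exists c : basis_index -> k, vge a (r - \sum_ij iota (c ij) * basis ij).
have quasiD (f1 f2 : K) : quasi f1 -> quasi f2 -> quasi (f1 + f2).
  by move=> q1 q2 g; rewrite rmorphD opprD addrACA; apply: (val_geD Kv).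
have RD f1 f2 : R f1 -> R f2 -> R (f1 + f2).
  move=> [q1 [c1 E1]] [q2 [c2 E2]]; split; first exact: quasiD.
  exists (fun ij => c1 ij + c2 ij).
  under eq_bigr do rewrite rmorphD mulrDl.
  by rewrite big_split opprD addrACA; apply: (val_geD Kv).
have Ra f1 : vge a f1 -> R f1.
  move=> f1a; split=> [g|]; first by apply: (val_geB Kv); rewrite ?(val_ge_tau (v_sigma g)).
  by exists (fun=> 0); rewrite big1 ?subr0 // => ij _; rewrite rmorph0 mul0r.
have Rbasis c ij : R (iota c * basis ij).
  split=> [g|].
    by rewrite rmorphM sigma_iota -mulrBr; apply: (val_geZ Kv); apply: basis_quasi.
  exists (fun ij' => if ij' == ij then c else 0).
  rewrite (bigD1 ij) //= eqxx big1 ?addr0 ?subrr ?val_ge0 // => ij' /negPf ->.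
  by rewrite rmorph0 mul0r.
suff split_i i : (i <= s)%N ->
    exists2 r, R r & exists2 g, g \in fixed (G i) & f = r + g.
  have [r [_ [c rc]] [g gS ->]] := split_i s (leqnn s).
  by exists c, g; rewrite ?addrK // -Gs.
elim: i => [_|i IHi lt_is].
  exists 0; first by apply: Ra; apply: val_ge0.
  by exists f; rewrite ?add0r // G0; apply/fixedP => g /set1P ->; rewrite sigma1.
have [r Rr [g gS fE]] := IHi (ltnW lt_is).
have [GG' xG' xG] := GS lt_is; have [uS u0 vu] := u_unif lt_is.
have lG' := G_level lt_is; rewrite expnS PoszM in lG'.
have [||r' Rr' [g' gS' gE]] := level_span (a := a) (R := R)
  (G_level (ltnW lt_is)) lG' GG' xG' xG uS u0 vu RD Ra _ gS.
- move=> c e pe /andP[ea1 ea2].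
  have A1 : e < A i by rewrite ltNge -aA -ltNge.
  have A2 : A i <= e + n%:Z.
    by rewrite -aA mulrDr; move: ea1; clear; lia.
  have jn : (`|(A i - 1 - e)%R| < n)%N by move: A1 A2; clear; lia.
  have eE : e = e_ (Ordinal lt_is, Ordinal jn).
    by rewrite /e_ /=; move: A1; clear; lia.
  move: pe; rewrite eE => pe.
  exact: (Rbasis c (exist _ (Ordinal lt_is, Ordinal jn) pe)).
- have -> : g = f - r by rewrite fE addrC addKr.
  have [rq _] := Rr; have := val_geB Kv (fq (x i)) (rq (x i)).
  rewrite rmorphB; congr (vge a _); ring.
by exists (r + r'); [exact: RD | exists g'; rewrite // fE gE addrA].
Qed.

(** If some coefficient were nonzero, g would have the valuation of a basis element, which is below
    a and not divisible by p^s, although g lies in K^H. *)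
Lemma basis_free (c : basis_index -> k) g : (G s : {set H}) = [set: H] ->
  g \in fixed [set: H] -> vge a (g - \sum_ij iota (c ij) * basis ij) ->
  forall ij, c ij = 0.
Proof.
move=> Gs gS ga; apply: contrapT => /existsNP[ij /eqP cij].
have b_inj : injective (v \o basis).
  move=> [[i j] pe] [[i' j'] pe'] /=; rewrite !v_basis /= => vE.
  have ii' : i = i'.
    apply/eqP; rewrite -val_eqE /= eqn_leq.
    apply/andP; split; rewrite leqNgt; apply/negP.
      by move/(pX_dvd)/(_ pe'); rewrite -vE dvdz_mulr.
    by move/(pX_dvd)/(_ pe); rewrite vE dvdz_mulr.
  apply: val_inj => /=; move: vE; rewrite -ii' => /(mulfI (pX_neq0 i)).
  rewrite /e_ /= => E; congr (_, _); apply: val_inj => /=.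
  by move: E; clear; lia.
have [ij0 [S0 vS]] := val_sum basis_neq0 b_inj (ex_intro _ ij cij).
set S := \sum_ij _ in ga S0 vS.
have [g0 vg] : g != 0 /\ v g = v S.
  rewrite -[g](subrK S) addrC; apply: (val_addl Kv) S0 _ ga.
  by rewrite vS basis_lt.
have [_ dvd _ _] := G_level (leqnn s).
have := dvd g; rewrite Gs => /(_ gS g0); rewrite vg vS v_basis pX_dvd //.
exact: (valP ij0).
Qed.

End Decomposition.

End Tower.

(** * The valuation of k((t)) *)

Section LaurentValuation.
Variable k : fieldType.
Local Notation L := (laurent k).
Local Notation t := (@laurent_t k).
Local Notation lau := (@fps_to_laurent k).
Local Notation vt := (@vt k).
Implicit Types (x y : L) (m : int) (c : k) (u w : fps k).

Definition laurent_const : k -> L := lau \o @fps_const k.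
HB.instance Definition _ := GRing.RMorphism.on laurent_const.

Lemma laurent_scaleE c x : c *: x = laurent_const c * x.
Proof. by []. Qed.

Lemma laurent_t_neq0 : t != 0.
Proof. by rewrite fps_to_laurent_eq0 fps_t_neq0. Qed.

Lemma vt_ge_neq0 m x : x != 0 -> vt_ge m x = (m <= vt x).
Proof. by rewrite /vt_ge => /negPf->. Qed.

Lemma lau_unit_neq0 u : u \is a GRing.unit -> lau u != 0.
Proof.
by move=> uU; rewrite fps_to_laurent_eq0; apply: contraTneq uU => ->; rewrite unitr0.
Qed.

Lemma fps_behead u : coefs u 0 = 0 -> exists w, u = fps_t k * w.
Proof.
move=> u0; exists (Fps (fun i => coefs u i.+1)).
by apply: fpsP => -[|i]; rewrite coefs_tM.
Qed.

Lemma vt_factor x : x != 0 ->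
  exists2 u, u \is a GRing.unit & x = t ^ vt x * lau u.
Proof.
move=> x0; have /vt_geP[f xE] : vt_ge (vt x) x by rewrite vt_ge_neq0.
exists f => //; apply/eqP => /fps_behead[g fE].
have: vt_ge (vt x + 1) x.
  apply/vt_geP; exists g; rewrite [in LHS]xE fE rmorphM mulrA.
  by rewrite [t ^ (_ + _)]expfzDr ?laurent_t_neq0.
by rewrite vt_ge_neq0 // gerDl.
Qed.

Lemma vt_unit m u : u \is a GRing.unit -> vt (t ^ m * lau u) = m.
Proof.
move=> uU; have u0 := lau_unit_neq0 uU.
have tm0 : t ^ m != 0 := expfz_neq0 m laurent_t_neq0.
have x0 := mulf_neq0 tm0 u0; apply/eqP; rewrite eq_le andbC.
apply/andP; split; first by rewrite -vt_ge_neq0 //; apply/vt_geP; exists u.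
rewrite leNgt -lezD1 -vt_ge_neq0 //; apply/negP => /vt_geP[g].
rewrite expfzDr ?laurent_t_neq0 // -mulrA => /(mulfI tm0).
rewrite expr1z -rmorphM => /eqP; rewrite -subr_eq0 -rmorphB fps_to_laurent_eq0.
by rewrite subr_eq0 => /eqP ug; move: uU; rewrite ug => /negP[]; rewrite coefs_tM.
Qed.

Lemma vt_t : vt t = 1.
Proof. by rewrite -(vt_unit 1 (unitr1 _)) expr1z rmorph1 mulr1. Qed.

Lemma laurent_lead x y : x != 0 -> y != 0 -> vt x = vt y ->
  exists2 c, c != 0 & vt_ge (vt x + 1) (x - laurent_const c * y).
Proof.
move=> /vt_factor[u uU xE] /vt_factor[w wU yE] xy.
have [u0 w0] : coefs u 0 != 0 /\ coefs w 0 != 0 by split.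
exists (coefs u 0 / coefs w 0); first by rewrite mulf_neq0 ?invr_eq0.
have [|r rE] := @fps_behead (u - fps_const (coefs u 0 / coefs w 0) * w).
  by rewrite /= big_ord_recl big_ord0 /= addr0 divfK // subrr.
apply/vt_geP; exists r.
have -> : t ^ (vt x + 1) * lau r = t ^ vt x * lau (fps_t k * r).
  by rewrite rmorphM mulrA expfzDr ?laurent_t_neq0.
rewrite -rE (rmorphB lau) (rmorphM lau) mulrBr -xE; congr (_ - _).
by rewrite [in LHS]yE -xy; apply: mulrCA.
Qed.

Lemma laurent_valuation : valuation laurent_const vt.
Proof.
split=> [m x y /vt_geP[f ->] /vt_geP[g ->]|x y|c c0|]; last exact: laurent_lead.
- by apply/vt_geP; exists (f + g); rewrite rmorphD mulrDr.
- move=> /vt_factor[u uU xE] /vt_factor[w wU yE].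
  rewrite xE yE mulrACA -rmorphM -expfzDr ?laurent_t_neq0 //.
  by rewrite !vt_unit // unitrM uU.
- have cU : fps_const c \is a GRing.unit by [].
  by rewrite -[laurent_const c]mul1r -(expr0z t) vt_unit.
Qed.

Lemma frac_idealE m x : (x \in frac_ideal m) = vt_ge m x.
Proof. by apply/asboolP/vt_geP. Qed.

End LaurentValuation.

(** * Chains in elementary abelian groups *)

Lemma elementary_chain (H : finGroupType) (p s : nat) :
  prime p -> #|[set: H]| = (p ^ s)%N -> (forall g : H, (g ^+ p = 1)%g) ->
  (forall g h : H, commute g h) ->
  exists (G : nat -> {group H}) (x : nat -> H),
    [/\ G 0%N = 1%G, G s = [set: H] :> {set H} &
      forall i, (i < s)%N -> x i \notin G i /\ G i.+1 = <<x i |: G i>>%G].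
Proof.
move=> p_pr cardH expH abH.
(* The default 1 is returned only when G is the whole group, which the order of [G i] excludes for i
   < s. *)
pose pt (G : {group H}) := odflt 1%g [pick x | x \notin G].
pose G i := iter i (fun G : {group H} => <<pt G |: G>>%G) 1%G.
have card_G i : (i <= s)%N ->
    #|G i| = (p ^ i)%N /\ ((i < s)%N -> pt (G i) \notin G i).
  elim: i => [|i IHi] lt_is.
    rewrite cards1 expn0; split=> // s_gt0; rewrite /pt; case: pickP => //= G1.
    have : (#|[set: H]| <= 1)%N.
      by rewrite -(cards1 (1 : H)%g) subset_leq_card //; apply/subsetP => g _;
         have /negbFE := G1 g.
    by rewrite cardH -(expn0 p) leqNgt ltn_exp2l ?prime_gt1 // s_gt0.
  have [cG /(_ lt_is) xG] := IHi (ltnW lt_is).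
  have cS : #|G i.+1| = (p ^ i.+1)%N.
    set x := pt (G i) in xG.
    have x1 : x != 1%g by apply: contraNneq xG => ->; rewrite group1.
    have ox : #[x]%g = p by apply: nt_prime_order.
    have -> : G i.+1 = (G i <*> <[x]>)%G.
      by apply: val_inj; rewrite /= joing_idr setUC.
    rewrite /= cent_joinEl; last by apply/centsP => g _ h _; apply: abH.
    rewrite TI_cardMg; first by rewrite cG -[#|<[x]>%g|]/(#[x])%g ox expnSr.
    by rewrite setIC prime_TIg ?cycle_subG // -[#|_|]/(#[x])%g ox.
  split=> // lt_is'; rewrite /pt; case: pickP => //= G1.
  have : (#|[set: H]| <= #|G i.+1|)%N.
    by rewrite subset_leq_card //; apply/subsetP => g _; have /negbFE := G1 g.
  by rewrite cardH cS leqNgt ltn_exp2l ?prime_gt1 // lt_is'.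
exists G, (fun i => pt (G i)); split=> // [|i lt_is].
  by apply/eqP; rewrite eqEcard subsetT cardH (proj1 (card_G s (leqnn s))) leqnn.
by split=> //; apply: (proj2 (card_G i (ltnW lt_is))).
Qed.

Lemma elementary_facts (H : finGroupType) (p s : nat) : prime p ->
  [set: H] \isog [set: 'rV['F_p]_s] ->
  [/\ #|[set: H]| = (p ^ s)%N, (forall g : H, (g ^+ p = 1)%g) &
      (forall g h : H, commute g h)].
Proof.
move=> p_pr isoH; have : (p.-abelem [set: H])%g.
  by rewrite (isog_abelem isoH); apply: mx_Fp_abelem.
move=> /(abelemP p_pr)[abH expH]; split=> [|g|g h].
- by rewrite (card_isog isoH) cardsT card_mx card_Fp // mul1n.
- by apply: expH; rewrite inE.
- by apply: (centsP abH); rewrite inE.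
Qed.

(** * Continuous automorphisms preserve the valuation *)

Section Isometry.
Variable k : fieldType.
Local Notation L := (laurent k).
Local Notation t := (@laurent_t k).
Local Notation lau := (@fps_to_laurent k).
Local Notation vt := (@vt k).
Local Notation Lv := (laurent_valuation k).

Lemma lrmorph_const (tau : {lrmorphism L -> L}) c :
  tau (laurent_const c) = laurent_const c.
Proof. by rewrite -[laurent_const c]mulr1 -laurent_scaleE linearZ /= rmorph1. Qed.

(** Continuity at 0 makes [tau] integral on t^N k[[t]] for some N. Writing f = c + t h lowers the
    exponent one step at a time, since [tau] fixes c and sends powers of t to integral elements. *)
Lemma continuous_vt_ge (tau : {lrmorphism L -> L}) m (x : L) :
  vt_continuous tau -> vt_ge 1 (tau t) -> 0 <= m -> vt_ge m x -> vt_ge m (tau x).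
Proof.
move=> /(_ 0 0)[N tauN] tau_t.
have tauX j : vt_ge j%:Z (tau (t ^+ j)).
  by rewrite rmorphXn; have := val_geX Lv j tau_t; rewrite mul1r.
have tau_int f : vt_ge 0 (tau (lau f)).
  suff H j : (j <= `|N|)%N -> forall f, vt_ge 0 (tau (t ^+ (`|N| - j) * lau f)).
    by have := H _ (leqnn _) f; rewrite subnn expr0 mul1r.
  elim: j => [_|j IHj lt_j] {}f.
    rewrite subn0 -[tau _]subr0 -(rmorph0 tau); apply: tauN; rewrite subr0.
    apply: (@val_ge_le _ vt _ `|N|%N%:Z); first by lia.
    by apply/vt_geP; exists f.
  pose g := f - fps_const (coefs f 0).
  have [|h gE] := @fps_behead _ g; first by rewrite /= subrr.
  have -> : lau f = laurent_const (coefs f 0) + t * lau h.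
    by rewrite -rmorphM -gE rmorphB addrC subrK.
  rewrite mulrDr mulrA -exprSr subnSK // rmorphD.
  apply: (val_geD Lv); last by apply: IHj; apply: ltnW.
  rewrite [_ * laurent_const _]mulrC rmorphM /= lrmorph_const; apply: (val_geZ Lv).
  by apply: val_ge_le (tauX _).
move=> m0; rewrite -(gez0_abs m0) => /vt_geP[f ->]; rewrite rmorphM.
by have := val_geM Lv (tauX `|m|%N) (tau_int f); rewrite addr0.
Qed.

(** The bound for [tau] and for its left inverse gives equality on nonnegative valuations; negative
    ones follow by passing to x^-1. *)
Lemma continuous_isometry (tau tau' : {lrmorphism L -> L}) :
  vt_continuous tau -> vt_ge 1 (tau t) -> vt_continuous tau' -> vt_ge 1 (tau' t) ->
  cancel tau tau' -> forall x, x != 0 -> vt (tau x) = vt x.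
Proof.
move=> ctau ttau ctau' ttau' tauK.
have nneg x : x != 0 -> 0 <= vt x -> vt (tau x) = vt x.
  move=> x0 vx; have tx0 : tau x != 0 by rewrite (fmorph_eq0 tau).
  have le1 : vt x <= vt (tau x).
    by rewrite -vt_ge_neq0 //; apply: continuous_vt_ge => //; rewrite vt_ge_neq0.
  have ttx0 : tau' (tau x) != 0 by rewrite tauK.
  apply/eqP; rewrite eq_le le1 andbT -[in X in _ <= X](tauK x).
  rewrite -vt_ge_neq0 //; apply: continuous_vt_ge => //.
    exact: le_trans le1.
  by rewrite vt_ge_neq0.
move=> x x0; have [vx|vx] := leP 0 (vt x); first exact: nneg.
have xV0 : x^-1 != 0 by rewrite invr_eq0.
apply: oppr_inj; rewrite -(valV Lv) ?(fmorph_eq0 tau) // -(valV Lv) // -(fmorphV tau).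
by apply: nneg; rewrite ?(valV Lv) ?oppr_ge0 // ltW.
Qed.

End Isometry.

(** * Group cohomology *)

Section Tame.
Variables (k K : fieldType) (iota : {rmorphism k -> K}) (v : K -> int).
Hypothesis Kv : valuation iota v.
Variable tau : {rmorphism K -> K}.
Hypotheses (v_tau : forall x : K, x != 0 -> v (tau x) = v x).
Hypotheses (tau_iota : forall c, tau (iota c) = iota c).
Local Notation vge := (val_ge v).

(* In characteristic p there are no nontrivial p-th roots of unity, so an
   element of order p is wildly ramified. *)
Lemma tame_trivial (p : nat) (t : K) : p \in [pchar k] -> t != 0 ->
  iter p tau t = t -> vge (v t + 1) (tau t - t).
Proof.
move=> p_char t0 tau_p.
have tt0 : tau t != 0 by rewrite fmorph_eq0.
have [c c0 tc] := val_lead Kv tt0 t0 (v_tau t0); rewrite v_tau // in tc.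
(* The j-th iterate multiplies the leading coefficient of t by c^j, so order p forces c^p = 1. *)
have tauj j : vge (v t + 1) (iter j tau t - iota (c ^+ j) * t).
  elim: j => [|j IHj]; first by rewrite expr0 rmorph1 mul1r subrr val_ge0.
  have -> : iter j.+1 tau t - iota (c ^+ j.+1) * t =
     tau (iter j tau t - iota (c ^+ j) * t) + iota (c ^+ j) * (tau t - iota c * t).
    by rewrite iterS rmorphB rmorphM tau_iota exprS rmorphM; ring.
  by apply: (val_geD Kv); rewrite ?(val_ge_tau v_tau) //; apply: (val_geZ Kv).
suff c1 : c = 1 by move: tc; rewrite c1 rmorph1 mul1r.
have := tauj p; rewrite tau_p.
have -> : t - iota (c ^+ p) * t = iota (1 - c ^+ p) * t by rewrite rmorphB rmorph1; ring.
have [cp|cp] := eqVneq (1 - c ^+ p) 0; last first.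
  by rewrite (val_ge_scaled Kv) // val_ge_neq0 // gerDl.
move=> _; apply/eqP; rewrite -subr_eq0.
have : (c - 1) ^+ p == 0.
  rewrite -(pFrobenius_autE p_char) pFrobenius_autB_comm ?pFrobenius_autE //; last exact: mulrC.
  by rewrite expr1n subr_eq0 eq_sym -subr_eq0 cp.
by rewrite expf_eq0 => /andP[].
Qed.

End Tame.

(** * Independence of characters and additive Hilbert 90 *)

Section Hilbert90.
Variables (K : fieldType) (H : finGroupType) (sigma : H -> {rmorphism K -> K}).
Hypotheses (sigma1 : sigma 1%g =1 id)
  (sigmaM : forall g h, sigma (g * h)%g =1 sigma g \o sigma h)
  (sigma_faithful : forall g, sigma g =1 id -> g = 1%g).

Lemma sigma_inj g h : sigma g =1 sigma h -> g = h.
Proof.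
move=> gh; apply: (mulgI h^-1%g); rewrite mulVg; apply: sigma_faithful => x.
by rewrite sigmaM /= gh -[LHS](sigmaM h^-1 h)%g mulVg sigma1.
Qed.

(** Artin's argument: subtracting [sigma g y] times the relation at x from the relation at y x
    removes the term of g and leaves a shorter relation. *)
Lemma sigma_independent (A : {set H}) (c : H -> K) :
  (forall x, \sum_(g in A) c g * sigma g x = 0) -> {in A, forall g, c g = 0}.
Proof.
move: {2}#|A| (leqnn #|A|) => m; elim: m A c => [|m IHm] A c.
  by rewrite leqn0 cards_eq0 => /eqP -> _ g; rewrite inE.
move=> cardA cA g gA.
have cardA' : (#|A :\ g| <= m)%N by rewrite (cardsD1 g A) gA in cardA.
have c0 h : h \in A :\ g -> c h = 0.
  move=> hA'; have hg : h != g by move: hA'; rewrite !inE => /andP[].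
  have [y yE] : exists y, sigma h y != sigma g y.
    apply: contrapT => no_y; case/eqP: hg; apply: sigma_inj => y.
    by apply/eqP/negPn/negP => hy; apply: no_y; exists y.
  have := IHm _ (fun h => c h * (sigma h y - sigma g y)) cardA' _ h hA'.
  move/(_ _)/eqP; rewrite mulf_eq0 subr_eq0 (negPf yE) orbF => H0.
  apply/eqP; apply: H0 => x.
  have E : (\sum_(f in A) c f * sigma f (y * x)) -
      sigma g y * (\sum_(f in A) c f * sigma f x) = 0 by rewrite !cA mulr0 subr0.
  rewrite big_distrr /= -sumrB (big_setD1 g gA) /= in E.
  rewrite -[RHS]E rmorphM mulrA [sigma g y * _]mulrA [sigma g y * c g]mulrC subrr add0r.
  by apply: eq_bigr => f _; rewrite rmorphM; ring.
have := cA 1; rewrite (big_setD1 g gA) /= big1 ?addr0 ?rmorph1 ?mulr1 // => h /c0 ->.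
by rewrite mul0r.
Qed.

(** By independence some z has nonzero trace; dividing by it gives y of trace 1, and f = - sum of
    c(h) sigma_h(y) trivialises the cocycle. *)
Lemma hilbert90 (c : H -> K) :
  (forall g h, c (g * h)%g = c g + sigma g (c h)) ->
  exists f, forall g, c g = sigma g f - f.
Proof.
move=> cZ.
have [z z0] : exists z, \sum_h sigma h z != 0.
  apply: contrapT => no_z.
  suff /eqP : (1 : K) = 0 by rewrite oner_eq0.
  apply: (@sigma_independent [set: H] (fun=> 1) _ 1%g (in_setT _)) => x.
  under eq_bigl do rewrite inE; under eq_bigr do rewrite mul1r.
  by apply/eqP/negPn/negP => hx; apply: no_z; exists x.
have reind (F : H -> K) g : \sum_h F (g * h)%g = \sum_h F h.
  by rewrite [RHS](reindex_inj (mulgI g)).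
set T := \sum_h _ in z0.
have sT g : sigma g T = T.
  rewrite rmorph_sum -[RHS](reind _ g); apply: eq_bigr => h _.
  by rewrite sigmaM.
pose y := z / T; have y1 : \sum_h sigma h y = 1.
  under eq_bigr do rewrite fmorph_div sT.
  by rewrite -big_distrl /= divff.
exists (- \sum_h c h * sigma h y) => g.
have -> : sigma g (- \sum_h c h * sigma h y) = - \sum_h (c h - c g) * sigma h y.
  rewrite rmorphN rmorph_sum; congr (- _).
  rewrite -[RHS](reind _ g); apply: eq_bigr => h _.
  by rewrite rmorphM cZ sigmaM addrC addKr.
under eq_bigr do rewrite mulrBl.
by rewrite sumrB -big_distrr /= y1 mulr1 opprB opprK subrK.
Qed.

End Hilbert90.

(** * Dimensions and the count of exponents *)

Lemma has_dim_basis (k : fieldType) (V : lmodType k) (I : finType) (b : I -> V) :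
  (forall c : I -> k, \sum_i c i *: b i = 0 -> forall i, c i = 0) ->
  (forall u, exists c : I -> k, u = \sum_i c i *: b i) ->
  has_dim V #|I|.
Proof.
move=> b_free b_span; have [C CE] := choice b_span.
have CE' c u : u = \sum_i c i *: b i -> C u =1 c.
  move=> uE i; apply/eqP; rewrite -subr_eq0; apply/eqP.
  apply: (b_free (fun i => C u i - c i)).
  by under eq_bigr do rewrite scalerBl; rewrite sumrB -CE -uE subrr.
constructor; exists (fun u => \row_(j < #|I|) C u (enum_val j)).
  move=> a u w; apply/rowP => j; rewrite !mxE.
  rewrite (CE' (fun i => a * C u i + C w i)) // [in LHS](CE u) [in LHS](CE w).
  under [RHS]eq_bigr do rewrite scalerDl -scalerA.
  by rewrite big_split scaler_sumr.
exists (fun r : 'rV_#|I| => \sum_i r 0 (enum_rank i) *: b i) => [u|r].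
  by rewrite [RHS]CE; apply: eq_bigr => i _; rewrite mxE enum_rankK.
by apply/rowP => j; rewrite mxE (CE' (fun i => r 0 (enum_rank i))) // enum_valK.
Qed.

Lemma floor_divz (m : int) (p : nat) : (0 < p)%N ->
  Num.floor (m%:~R / p%:R : rat) = (m %/ p)%Z.
Proof.
move=> p_gt0; have pR : (0 : rat) < p%:R by rewrite ltr0n.
apply: floor_def; rewrite ler_pdivlMr // ltr_pdivrMr //.
rewrite -[p%:R]/(p%:Z%:~R : rat) -!rmorphM ler_int ltr_int.
by rewrite lez_floor ?ltz_ceil //; lia.
Qed.

Lemma ceil_divz_le (m e : int) (p : nat) : (0 < p)%N ->
  (Num.ceil (m%:~R / p%:R : rat) <= e) = (m <= p%:Z * e).
Proof.
move=> p_gt0; have pR : (0 : rat) < p%:R by rewrite ltr0n.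
rewrite ceil_le_int ler_pdivrMr // -[p%:R]/(p%:Z%:~R : rat) -rmorphM ler_int.
by rewrite mulrC.
Qed.

(** Nested ceilings collapse: a_(i+1) is the ceiling of a / p^i, expressed here by its universal
    property. *)
Lemma ceil_seqP (p : nat) (a : int) (i : nat) (e : int) : (0 < p)%N ->
  (a <= (p ^ i)%:Z * e) = (ceil_seq p a i.+1 <= e).
Proof.
move=> p_gt0; elim: i e => [|i IHi] e; first by rewrite expn0 mul1r.
by rewrite [in RHS]/= ceil_divz_le // -IHi mulrA -PoszM mulnC -expnS.
Qed.

(** Induction on n: raising n by one adds p - 1 to a numerator congruent to m = a - 1 - n modulo p,
    so the floor grows by one exactly when p does not divide m. *)
Lemma count_ndvd (p n : nat) (a : int) : (0 < p)%N ->
  (\sum_(j < n) (~~ (p%:Z %| (a - 1 - j%:Z)%R)%Z : nat))%N%:Z =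
  Num.floor (((n%:Z + 1) * (p%:Z - 1) + a)%:~R / p%:R : rat) -
  Num.ceil (a%:~R / p%:R : rat).
Proof.
move=> p_gt0; have p0 : p%:Z != 0 by lia.
have pp : 0 < p%:Z by lia.
rewrite floor_divz //; elim: n => [|n IHn].
  (* For n = 0 the floor of (a + p - 1) / p is the ceiling of a / p. *)
  rewrite big_ord0 add0r mul1r; apply/esym/eqP; rewrite subr_eq0 eq_le.
  apply/andP; split; last first.
    rewrite ceil_divz_le // mulrC; have := ltz_ceil (p%:Z - 1 + a) pp.
    by move: (_ %/ _)%Z => q; lia.
  rewrite -ltzD1 ltz_divLR //.
  have : a <= p%:Z * Num.ceil (a%:~R / p%:R : rat) by rewrite -ceil_divz_le.
  by move: (Num.ceil _) => q; lia.
rewrite big_ord_recr /= PoszD IHn addrAC; congr (_ - _).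
set m := a - 1 - n%:Z.
have -> : (n%:Z + 1) * (p%:Z - 1) + a = n%:Z * p%:Z + (m + p%:Z) by rewrite /m; ring.
have -> : (n.+1%:Z + 1) * (p%:Z - 1) + a = n%:Z * p%:Z + (m + p%:Z) + (p%:Z - 1).
  by rewrite /m intS; ring.
have -> : n%:Z * p%:Z + (m + p%:Z) = (n%:Z + 1) * p%:Z + m by ring.
rewrite -addrA !divzMDl // -addrA; congr (_ + _); clearbody m.
rewrite {1 3}(divz_eq m p) (sameP dvdz_mod0P eqP).
have r_ge0 := modz_ge0 m p0; have r_lt := ltz_pmod m pp.
move: (modz m p) r_ge0 r_lt => r r_ge0 r_lt.
rewrite -[in RHS]addrA !divzMDl // -addrA; congr (_ + _).
rewrite divz_small; last by lia.
rewrite add0r; have [->|r0] := eqVneq r 0; first by rewrite divz_small //; lia.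
have -> : r + (p%:Z - 1) = 1 * p%:Z + (r - 1) by ring.
by rewrite divzMDl // divz_small //; lia.
Qed.

(** * From quasi-invariant elements to cohomology classes *)

Section H1Dimension.
Variables (k : fieldType) (H : finGroupType).
Variables (sigma : H -> {lrmorphism laurent k -> laurent k}) (a : int).
Local Notation L := (laurent k).
Local Notation Z1 := (Z1 sigma a).
Local Notation B1 := (@coboundary _ _ sigma a).
Local Notation pi := (\pi_(H1 sigma a))%qT.
Implicit Types (f m : L).

Lemma pi_sum (I : finType) (c : I -> k) (z : I -> Z1) :
  \sum_i c i *: (pi (z i) : H1 sigma a) = pi (\sum_i c i *: z i).
Proof.
have piD : {morph (fun u : Z1 => pi u : H1 sigma a) : u w / u + w}.
  exact: quotmod_piD.
have pi0 : (pi (0 : Z1) : H1 sigma a) = 0.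
  by apply: (addrI (pi (0 : Z1) : H1 sigma a)); rewrite -piD !addr0.
rewrite (big_morph _ piD pi0); apply: eq_bigr => i _.
exact/esym/quotmod_piZ.
Qed.

Lemma cocycle_sum (I : finType) (c : I -> k) (z : I -> Z1) g :
  cocycle_fun (\sum_i c i *: z i) g = \sum_i c i *: cocycle_fun (z i) g.
Proof.
have evD : {morph (fun u : Z1 => cocycle_fun u g) : u w / u + w}.
  by move=> u w; rewrite ffunE.
have ev0 : cocycle_fun (0 : Z1) g = 0 by rewrite ffunE.
by rewrite (big_morph _ evD ev0); apply: eq_bigr => i _; rewrite ffunE.
Qed.

Hypothesis sigma_act : galois_action sigma.

Fact twist_cocycle f : (forall g, vt_ge a (sigma g f - f)) ->
  [ffun g => sigma g f - f] \in cocycle sigma a.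
Proof.
have [_ sM _ _] := sigma_act.
move=> fq; apply/asboolP; split=> [g|g h]; rewrite !ffunE ?frac_idealE //.
by rewrite sM /= rmorphB /= [RHS]addrC addrA subrK.
Qed.

Definition twist f (fq : forall g, vt_ge a (sigma g f - f)) : Z1 :=
  Cocycle (twist_cocycle fq).

Lemma cocycle_twist (z : Z1) : exists2 f,
  (forall g, vt_ge a (sigma g f - f)) & forall g, cocycle_fun z g = sigma g f - f.
Proof.
have /asboolP[zA zM] := cocycle_funP z; have [s1 sM sF _] := sigma_act.
have [f zf] := @hilbert90 _ _ (fun g => sigma g : {rmorphism L -> L}) s1 sM sF _ zM.
by exists f => // g; rewrite -zf -frac_idealE.
Qed.

(** By Hilbert 90 every class comes from some f. The cocycle of f is the coboundary of m in A
    exactly when f - m is fixed by H, so the last two hypotheses say that the classes of the b i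
    span and are independent. *)
Lemma H1_has_dim (I : finType) (b : I -> L) :
  (forall i g, vt_ge a (sigma g (b i) - b i)) ->
  (forall f, (forall g, vt_ge a (sigma g f - f)) -> exists c : I -> k,
    exists2 y, (forall g, sigma g y = y) & vt_ge a (f - y - \sum_i c i *: b i)) ->
  (forall (c : I -> k) y, (forall g, sigma g y = y) ->
    vt_ge a (y - \sum_i c i *: b i) -> forall i, c i = 0) ->
  has_dim (H1 sigma a) #|I|.
Proof.
move=> bq b_span b_free; pose z i := twist (bq i).
have sumE (c : I -> k) g : cocycle_fun (\sum_i c i *: z i) g =
    sigma g (\sum_i c i *: b i) - \sum_i c i *: b i.
  rewrite cocycle_sum rmorph_sum /= -sumrB; apply: eq_bigr => i _.
  by rewrite ffunE scalerBr [sigma g (_ *: _)]linearZ.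
apply: (@has_dim_basis _ _ _ (fun i => pi (z i) : H1 sigma a)) => [c|u].
  rewrite pi_sum => c0.
  have /asboolP[m mA zm] : \sum_i c i *: z i \in B1.
    rewrite -[\sum_i _]subr0; apply/quotmod_eqP; rewrite c0.
    (* The empty sum shows that the class of 0 is 0. *)
    have := pi_sum (fun i => 0) (fun i : 'I_0 => 0 : Z1).
    by rewrite !big_ord0.
  apply: (b_free c (\sum_i c i *: b i - m)) => [g|].
    have := zm g; rewrite sumE rmorphB /= => E.
    by rewrite -[sigma g (\sum_i _)](subrK (\sum_i c i *: b i)) E; ring.
  by rewrite addrAC subrr add0r -frac_idealE rpredN.
have [f fq uf] := cocycle_twist (generic_quotient.repr u).
have [c [y y_fix fy]] := b_span f fq; exists c; rewrite pi_sum -[u]reprK.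
apply/quotmod_eqP/asboolP; exists (f - y - \sum_i c i *: b i).
  by rewrite frac_idealE.
move=> g; rewrite ffunE uf; have := sumE c g.
rewrite /= !ffunE => ->; rewrite !rmorphB /= y_fix; ring.
Qed.

End H1Dimension.

Lemma card_basis_index (p n s : nat) (a : int) : (0 < p)%N ->
  #|{: basis_index p n s (fun i => ceil_seq p a i.+1)}|%:Z =
  \sum_(1 <= i < s.+1)
    (Num.floor (((n%:Z + 1) * (p%:Z - 1) + ceil_seq p a i)%:~R / p%:R : rat)
     - Num.ceil ((ceil_seq p a i)%:~R / p%:R : rat)).
Proof.
move=> p_gt0; rewrite big_add1 big_mkord /= card_sig -sum1_card.
rewrite -(pair_big_dep xpredT (fun (i : 'I_s) (j : 'I_n) =>
    ~~ (p%:Z %| (ceil_seq p a i.+1 - 1 - j%:Z)%R)%Z) (fun _ _ => 1%N)) /=.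
rewrite (big_morph Posz PoszD (erefl _)); apply: eq_bigr => i _.
by rewrite -count_ndvd // big_mkcond.
Qed.

Lemma H1_dim (k : fieldType) (p : nat) (p_char : p \in [pchar k])
    (H : finGroupType) (s : nat) (H_elem : [set: H] \isog [set: 'rV['F_p]_s])
    (sigma : H -> {lrmorphism laurent k -> laurent k})
    (H_act : galois_action sigma) (n : nat)
    (H_ram : forall i : nat, (i <= n)%N -> ram_group sigma i = [set: H])
    (H_jump : ram_group sigma n.+1 \proper ram_group sigma n)
    (H_triv : ram_group sigma n.+1 = [set 1%g]) (a : int) :
  has_dim (H1 sigma a) #|{: basis_index p n s (fun i => ceil_seq p a i.+1)}|.
Proof.
have p_pr : prime p := pcharf_prime p_char; have p_gt0 := prime_gt0 p_pr.
have [cardH expH abH] := elementary_facts p_pr H_elem.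
have [s1 sM sF sC] := H_act.
pose Lv := laurent_valuation k; pose t := @laurent_t k.
have t0 : t != 0 := laurent_t_neq0 k; have vtt : vt t = 1 := vt_t k.
pose sig g : {rmorphism laurent k -> laurent k} := sigma g.
have sig_const g c : sig g (laurent_const c) = laurent_const c := lrmorph_const _ _.
have [x1 x1_neq1] : exists x : H, x != 1%g.
  have : [set 1%g] \proper [set: H] by rewrite -H_triv -(H_ram n (leqnn n)).
  by case/properP => _ [x _]; rewrite inE; exists x.
(* [ram_group sigma 0] being everything gives the positivity of v(sigma g t) that the isometry lemma
   requires. *)
have sig_t g : vt_ge 1 (sigma g t).
  rewrite -[sigma g t](subrK t); apply: (val_geD Lv).
    by have : g \in ram_group sigma 0 by [rewrite H_ram ?inE]; rewrite inE.
  by rewrite -vtt; apply: val_ge_val.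
have v_sig g (x : laurent k) : x != 0 -> vt (sig g x) = vt x.
  apply: (continuous_isometry (tau' := sigma g^-1%g)) => // y.
  by rewrite -[LHS](sM g^-1 g)%g mulVg s1.
have t_jump x : x != 1%g ->
    val_ge (@vt k) (n%:Z + 1) (sig x t - t) /\
    ~~ val_ge (@vt k) (n%:Z + 2) (sig x t - t).
  move=> x_neq1; split.
    have : x \in ram_group sigma n by rewrite H_ram ?inE.
    by rewrite inE -[n.+1]addn1.
  have : x \notin ram_group sigma n.+1 by rewrite H_triv inE.
  by rewrite inE -[n.+2]addn2.
(* For n = 0, [x1] would move t by valuation exactly 1, against wild ramification of elements of
   order p. *)
have n_gt0 : 0 < n%:Z.
  rewrite ltz_nat lt0n; apply/eqP => n0; have [_] := t_jump x1 x1_neq1; rewrite n0.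
  apply/negP/negPn; have := tame_trivial Lv (v_sig x1) (sig_const x1) p_char t0.
  by rewrite vtt; apply; rewrite -(sigmaX (sigma := sig) s1 sM) expH [LHS]s1.
have pn := jump_ndvd Lv t0 vtt p_char s1 sM sig_const v_sig expH n_gt0 t_jump
  (ex_intro _ x1 x1_neq1).
have l0 := level_base Lv t0 vtt p_char s1 sig_const v_sig n_gt0 t_jump.
have [G [x [G0 Gs Gx]]] := elementary_chain p_pr cardH expH abH.
have lG : forall i, (i <= s)%N -> level (@vt k) p sig n%:Z (p ^ i)%:Z (G i).
  apply: (level_tower (x := x) Lv t0 vtt p_char s1 sM sig_const v_sig abH expH
    n_gt0 pn) => //.
  by rewrite G0.
have [i|u u_unif] := @choice nat (laurent k) (fun i y => (i < s)%N ->
    [/\ y \in fixed sig (G i), y != 0 & vt y = (p ^ i)%:Z]).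
  have [lt_is|_] := ltnP i s; last by exists 0.
  by have [_ _ [y yS [y0 vy]] _] := lG i (ltnW lt_is); exists y.
have GS i : (i < s)%N -> [/\ G i \subset G i.+1, x i \in G i.+1 & x i \notin G i].
  move=> lt_is; have [xG GE] := Gx i lt_is.
  have sub : x i |: G i \subset G i.+1 by rewrite GE subset_gen.
  split=> //; first by apply: subset_trans sub; apply: subsetUr.
  by apply: (subsetP sub); rewrite setU11.
have aA i e := ceil_seqP a i e p_gt0.
apply: (H1_has_dim H_act (b := basis u)).
- move=> ij g; exact: (basis_quasi Lv aA lG u_unif ij g).
- move=> f fq.
  have [c [y yS fy]] :=
    basis_span Lv s1 sig_const v_sig aA lG G0 GS u_unif Gs fq.
  by exists c, y => // g; move/fixedP: yS; apply; rewrite inE.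
move=> c y y_fix ya; apply: (basis_free Lv p_char aA lG u_unif (g := y)) => //.
by apply/fixedP => g _; apply: y_fix.
Qed.

Theorem proposition2p8
    (k : closedFieldType) (p : nat) (p_char : p \in [pchar k]) (p_ge5 : (5 <= p)%N)
    (H : finGroupType) (s : nat)
    (H_elem : [set: H] \isog [set: 'rV['F_p]_s])
    (sigma : H -> {lrmorphism laurent k -> laurent k})
    (H_act : galois_action sigma)
    (n : nat)
    (H_ram : forall i : nat, (i <= n)%N -> ram_group sigma i = [set: H])
    (H_jump : ram_group sigma n.+1 \proper ram_group sigma n)
    (H_triv : ram_group sigma n.+1 = [set 1%g])
    (a : int) :
  (exists2 d : nat, has_dim (H1 sigma a) d &
     d%:Z = \sum_(1 <= i < s.+1)
       (Num.floor (((n%:Z + 1) * (p%:Z - 1) + ceil_seq p a i)%:~R / p%:R : rat)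
        - Num.ceil ((ceil_seq p a i)%:~R / p%:R : rat)))
  /\
  (exists2 d : nat, has_dim (H1 sigma 0) d &
     d%:Z = s%:Z * Num.floor (((n%:Z + 1) * (p%:Z - 1))%:~R / p%:R : rat)).
Proof.
have p_gt0 : (0 < p)%N by apply: leq_trans p_ge5.
split; eexists; try exact: (H1_dim p_char H_elem H_act H_ram H_jump H_triv).
  exact: card_basis_index.
rewrite card_basis_index //.
have ceil_seq0 i : ceil_seq p 0 i = 0.
  by elim: i => //= -[|i] //= ->; rewrite mul0r ceil0.
under eq_bigr do rewrite ceil_seq0 mul0r ceil0 subr0 addr0.
by rewrite sumr_const_nat subn1 -[s%:Z]natz mulr_natl.
Qed.
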